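(* Let $X$ and $Y$ be connected CW complexes. If a map $f\colon Y\to X$ induces an isomorphism of fundamental groups, then $\mathrm{dcat}_1(Y)\le\mathrm{dcat}_1(X)$.
   Context: All spaces are connected CW complexes and maps are continuous. For a space $Z$ and an integer $n\ge 1$, let $\mathcal B_n(Z)$ be the set of probability measures on $Z$ supported on at most $n$ points, i.e. formal sums $\sum_{i=1}^n a_i z_i$ with $z_i\in Z$, $a_i\ge 0$, $\sum a_i=1$ (a point $z$ standing for the Dirac measure $\delta_z$). It carries the topology of weak convergence of measures; for metric $Z$ this is the topology of the Lévy–Prokhorov metric. For a map $f\colon E\to B$ put $E_n=\{\mu\in\mathcal B_n(E)\mid \mathrm{supp}(\mu)\subset f^{-1}(b)\text{ for some } b\in B\}$, a subspace of $\mathcal B_n(E)$, and let $f_n\colon E_n\to B$ send $\mu$ to that $b$. If $f$ is a fibration, then so is $f_n$. The distributional one-category $\mathrm{dcat}_1(X)$ is the least integer $n\ge 0$ such that $q^X_{n+1}\colon \widetilde X_{n+1}\to X$ has a section, where $q^X\colon\widetilde X\to X$ is the universal covering ($\infty$ if no such $n$ exists). *)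

(* Defs.v *)
From HB Require Import structures.
From mathcomp Require Import all_boot all_order all_algebra.
From mathcomp Require Import generic_quotient lra.
From mathcomp Require Import all_classical all_reals all_analysis.
From mathcomp Require Import homotopy.

Set Implicit Arguments.
Unset Strict Implicit.
Unset Printing Implicit Defensive.

Import Order.TTheory GRing.Theory Num.Theory.
Import numFieldNormedType.Exports.

Local Open Scope classical_set_scope.
Local Open Scope quotient_scope.
Local Open Scope ring_scope.

Definition unit_interval (R : realType) := set_type (`[0, 1]%classic : set R).

Section unit_interval.
Context {R : realType}.
Local Notation I := (unit_interval R).

HB.instance Definition _ :=
  Topological.copy I (set_type (`[0, 1]%classic : set R)).

Lemma clampP (r : R) : Num.min 1 (Num.max 0 r) \in (`[0, 1]%classic : set R).
Proof.
by rewrite inE/= in_itv/= le_min ler01 le_max lexx ge_min lexx.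
Qed.

Definition clamp (r : R) : I := @exist _ (fun x => x \in (`[0, 1]%classic : set R)) _ (clampP r).

Lemma clampE (r : R) : set_val (clamp r) = Num.min 1 (Num.max 0 r).
Proof. by []. Qed.

Lemma unit_interval_bound (t : I) : 0 <= set_val t <= 1.
Proof. by have := set_valP t; rewrite /= in_itv. Qed.

Lemma clampK : cancel (set_val : I -> R) clamp.
Proof.
move=> t; apply: val_inj; have /andP[t0 t1] := unit_interval_bound t.
by rewrite -[LHS]/(set_val _) clampE max_r// min_r.
Qed.

Lemma zero_neq_one_itv : clamp 0 != clamp 1.
Proof.
apply/eqP => /(congr1 set_val); rewrite !clampE.
by rewrite maxxx min_r// max_r// minxx => /esym/eqP; rewrite oner_eq0.
Qed.

HB.instance Definition _ := @isBiPointed.Build I (clamp 0) (clamp 1)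
  zero_neq_one_itv.

Lemma val_zero : set_val (zero : I) = 0 :> R.
Proof. by rewrite clampE maxxx min_r. Qed.

Lemma val_one : set_val (one : I) = 1 :> R.
Proof. by rewrite clampE max_r// minxx. Qed.

Lemma clamp_continuous : continuous clamp.
Proof.
apply: continuous_comp_initial => r.
have cmax : {for r, continuous (fun s : R => Num.max 0 s)}.
  by apply: (@continuous_max R R (cst 0) id r); [exact: cst_continuous|exact: cvg_id].
by apply: (@continuous_min R R (cst 1) (fun s => Num.max 0 s) r) => //;
  exact: cst_continuous.
Qed.

Lemma itv_val_continuous : continuous (set_val : I -> R).
Proof. exact: initial_continuous. Qed.

End unit_interval.

Lemma glue_continuous {R : realType} {T X : topologicalType} (h : T -> R)
    (f g : T -> X) : continuous h -> continuous f -> continuous g ->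
  (forall t, h t = 2^-1 -> f t = g t) ->
  continuous (fun t => if h t <= 2^-1 then f t else g t).
Proof.
move=> ch cf cg fg t; have [ht|ht|ht] := ltgtP (h t) 2^-1.
- have ht' : \forall u \near t, h u < 2^-1.
    by apply: (ch t [set r | r < 2^-1]); exact: lt_nbhsl.
  move=> V /=; rewrite ifT ?ltW// => fV; have Hf := cf t V fV.
  change (\near t, V (if h t <= 2^-1 then f t else g t)); near=> u => /=; rewrite ifT; first by near: u.
  by apply: ltW; near: u.
- have ht' : \forall u \near t, 2^-1 < h u.
    by apply: (ch t [set r | 2^-1 < r]); exact: lt_nbhsr.
  move=> V /=; rewrite ifF => [gV|]; last by apply/negbTE; rewrite -ltNge.
  have Hg := cg t V gV.
  change (\near t, V (if h t <= 2^-1 then f t else g t)); near=> u => /=; rewrite ifF; first by near: u.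
  by apply/negbTE; rewrite -ltNge; near: u.
- move=> V /=; rewrite ifT ?ht// => fV; have gV := fV; rewrite (fg _ ht) in gV.
  have Hf := cf t V fV; have Hg := cg t V gV.
  change (\near t, V (if h t <= 2^-1 then f t else g t)); near=> u => /=.
  by case: ifPn => _; near: u.
Unshelve. all: by end_near. Qed.


Section unit_interval_maps.
Context {R : realType}.
Local Notation I := (unit_interval R).

Lemma clamp_half (r : R) : r = 2^-1 ->
  (clamp (2 * r) = one) * (clamp (2 * r - 1) = zero).
Proof. by move=> ->; rewrite divff ?pnatr_eq0// subrr. Qed.

Lemma clamp_affine_continuous (a b : R) :
  continuous (fun t : I => clamp (a * set_val t + b)).
Proof.
move=> t; apply: (@continuous_comp I R I (fun t => a * set_val t + b) clamp);
  last exact: clamp_continuous.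
apply: (@continuousD R R I (fun t => a * set_val t) (cst b));
  last exact: cst_continuous.
apply: (@continuousM R I (cst a) set_val); first exact: cst_continuous.
exact: itv_val_continuous.
Qed.

End unit_interval_maps.

Section paths.
Context {R : realType} {X : topologicalType}.
Local Notation I := (unit_interval R).

Definition path_cat (p q : I -> X) (t : I) : X :=
  if set_val t <= 2^-1 then p (clamp (2 * set_val t))
  else q (clamp (2 * set_val t - 1)).

Definition path_rev (p : I -> X) (t : I) : X := p (clamp (1 - set_val t)).

Lemma path_cat_continuous (p q : I -> X) :
  continuous p -> continuous q -> p one = q zero -> continuous (path_cat p q).
Proof.
move=> cp cq pq; apply: glue_continuous; first exact: itv_val_continuous.
- move=> t; apply: continuous_comp; last exact: cp.
  have := @clamp_affine_continuous R 2 0 t.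
  by under eq_fun do rewrite addr0.
- move=> t; apply: continuous_comp; last exact: cq.
  exact: clamp_affine_continuous.
- by move=> t /clamp_half[-> ->].
Qed.

Lemma path_cat0 (p q : I -> X) : path_cat p q zero = p zero.
Proof. by rewrite /path_cat val_zero invr_ge0 ler0n mulr0. Qed.

Lemma path_cat1 (p q : I -> X) : path_cat p q one = q one.
Proof.
rewrite /path_cat val_one ifF; last by apply/negbTE; rewrite -ltNge; lra.
by congr (q (clamp _)); lra.
Qed.

Lemma path_rev_continuous (p : I -> X) : continuous p -> continuous (path_rev p).
Proof.
move=> cp t; apply: continuous_comp; last exact: cp.
have := @clamp_affine_continuous R (-1) 1 t.
by under eq_fun do rewrite mulN1r addrC.
Qed.

Lemma path_rev0 (p : I -> X) : path_rev p zero = p one.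
Proof. by rewrite /path_rev val_zero subr0. Qed.

Lemma path_rev1 (p : I -> X) : path_rev p one = p zero.
Proof. by rewrite /path_rev val_one subrr. Qed.

Lemma reparam_time_continuous (H : I * I -> X) (c : I -> I) :
  continuous H -> continuous c -> continuous (fun z => H (z.1, c z.2)).
Proof.
move=> cH cc z.
apply: (@continuous_comp _ _ _ (fun z : I * I => (z.1, c z.2)) H); last exact: cH.
apply: (@cvg_pair _ _ _ _ (nbhs z.1) (nbhs (c z.2))); first exact: cvg_fst.
by apply: (@continuous_comp _ _ _ snd c); [exact: cvg_snd|exact: cc].
Qed.

End paths.

Section fundamental_group.
Context {R : realType} {X : topologicalType}.
Local Notation I := (unit_interval R).
Variable x : X.

Definition loop := {path I from x to x in X}.
HB.instance Definition _ := Choice.on loop.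

Definition loop_cat (p q : loop) : loop :=
  [the {path I from x to x in X} of
   mk_path (path_cat_continuous (@cts_fun _ _ p) (@cts_fun _ _ q)
              (etrans (@path_one _ _ _ _ p) (esym (@path_zero _ _ _ _ q))))
     (etrans (path_cat0 p q) (@path_zero _ _ _ _ p))
     (etrans (path_cat1 p q) (@path_one _ _ _ _ q))].

Definition loop_rev (p : loop) : loop :=
  [the {path I from x to x in X} of
   mk_path (path_rev_continuous (@cts_fun _ _ p))
     (etrans (path_rev0 p) (@path_one _ _ _ _ p))
     (etrans (path_rev1 p) (@path_zero _ _ _ _ p))].

Definition loop_cst : loop := [the {path I from x to x in X} of cst x].

Definition homotopic (p q : loop) : Prop :=
  exists H : I * I -> X, [/\ continuous H,
    forall t, H (t, zero) = p t, forall t, H (t, one) = q t &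
    forall u, H (zero, u) = x /\ H (one, u) = x].

Lemma homotopic_refl p : homotopic p p.
Proof.
exists (p \o fst); split=> //=.
- by move=> z; apply: continuous_comp; [exact: cvg_fst|exact: cts_fun].
- by move=> u; rewrite path_zero path_one.
Qed.

Lemma homotopic_sym p q : homotopic p q -> homotopic q p.
Proof.
move=> [H [cH H0 H1 Hu]].
exists (fun z => H (z.1, clamp (1 - set_val z.2))); split=> //=.
- apply: (@reparam_time_continuous R X H (fun u => clamp (1 - set_val u))) => //.
  exact: (@path_rev_continuous R I idfun (fun=> cvg_id)).
- by move=> t; rewrite val_zero subr0.
- by move=> t; rewrite val_one subrr.
Qed.

Lemma homotopic_trans q p r : homotopic p q -> homotopic q r -> homotopic p r.
Proof.
move=> [H [cH H0 H1 Hu]] [K [cK K0 K1 Ku]].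
have cpl (F : I * I -> X) (a b : R) : continuous F ->
    continuous (fun z : I * I => F (z.1, clamp (a * set_val z.2 + b))).
  move=> cF; apply: (@reparam_time_continuous R X F (fun u : I => clamp (a * set_val u + b))) => //.
  exact: clamp_affine_continuous.
exists (fun z => if set_val z.2 <= 2^-1 :> R then H (z.1, clamp (2 * set_val z.2 + 0))
                 else K (z.1, clamp (2 * set_val z.2 + -1))); split.
- apply: glue_continuous; [|exact: cpl|exact: cpl|].
    move=> z; apply: continuous_comp; first exact: cvg_snd.
    exact: itv_val_continuous.
  by move=> z /clamp_half[h1 h2]; rewrite addr0 h1 h2 H1 K0.
- by move=> t /=; rewrite val_zero invr_ge0 ler0n mulr0 addr0 H0.
- move=> t /=; rewrite val_one ifF; last by apply/negbTE; rewrite -ltNge; lra.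
  by rewrite -K1; congr (K (_, clamp _)); lra.
- by move=> u /=; case: ifP => _; rewrite ?(Hu _).1 ?(Hu _).2 ?(Ku _).1 ?(Ku _).2.
Qed.


Lemma homotopic_reparam (a : I -> X) (phi psi : I -> I) (p q : loop) :
  continuous a -> continuous phi -> continuous psi ->
  phi zero = psi zero -> phi one = psi one ->
  p =1 a \o phi -> q =1 a \o psi -> homotopic p q.
Proof.
move=> ca cphi cpsi e0 e1 pE qE.
exists (fun z : I * I => a (clamp ((1 - set_val z.2) * set_val (phi z.1) +
                           set_val z.2 * set_val (psi z.1)))); split => /=.
- move=> z; apply: continuous_comp; last exact: ca.
  apply: continuous_comp; last exact: clamp_continuous.
  have c2 : {for z, continuous (fun z : I * I => set_val z.2 : R)}.
    apply: (@continuous_comp _ _ _ snd); first exact: cvg_snd.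
    exact: itv_val_continuous.
  have c1 (h : I -> I) : continuous h ->
      {for z, continuous (fun z : I * I => set_val (h z.1) : R)}.
    move=> ch; apply: (@continuous_comp _ _ _ fst (set_val \o h)).
      exact: cvg_fst.
    by apply: continuous_comp; [exact: ch|exact: itv_val_continuous].
  apply: (@continuousD R R (I * I)%type
    (fun z => (1 - set_val z.2) * set_val (phi z.1))
    (fun z => set_val z.2 * set_val (psi z.1))).
    apply: (@continuousM R (I * I)%type (fun z => 1 - set_val z.2)
      (fun z => set_val (phi z.1))); last exact: c1.
    apply: (@continuousB R R (I * I)%type (cst 1) (fun z => set_val z.2)) => //.
    exact: cst_continuous.
  apply: (@continuousM R (I * I)%type (fun z => set_val z.2)
    (fun z => set_val (psi z.1))) => //; exact: c1.
- by move=> t; rewrite val_zero subr0 mul1r mul0r addr0 clampK pE.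
- by move=> t; rewrite val_one subrr mul0r mul1r add0r clampK qE.
- move=> u; rewrite e0 e1 -!mulrDl subrK !mul1r !clampK.
  by rewrite -[a (psi zero)]qE -[a (psi one)]qE path_zero path_one.
Qed.

Lemma homotopic_cat p p' q q' :
  homotopic p p' -> homotopic q q' ->
  homotopic (loop_cat p q) (loop_cat p' q').
Proof.
move=> [H [cH H0 H1 Hu]] [K [cK K0 K1 Ku]].
exists (fun z : I * I => if set_val z.1 <= 2^-1 :> R then H (clamp (2 * set_val z.1 + 0), z.2)
                 else K (clamp (2 * set_val z.1 + -1), z.2)); split.
- have cpl (F : I * I -> X) (a b : R) : continuous F ->
      continuous (fun z : I * I => F (clamp (a * set_val z.1 + b), z.2)).
    move=> cF z.
    apply: (@continuous_comp _ _ _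
      (fun z : I * I => (clamp (a * set_val z.1 + b) : I, z.2)) F); last exact: cF.
    apply: (@cvg_pair _ _ _ _ (nbhs (clamp (a * set_val z.1 + b) : I))
      (nbhs z.2)); last exact: cvg_snd.
    apply: (@continuous_comp _ _ _ fst (fun u : I => clamp (a * set_val u + b) : I)).
      exact: cvg_fst.
    exact: clamp_affine_continuous.
  apply: glue_continuous; [|exact: cpl|exact: cpl|].
    move=> z; apply: continuous_comp; first exact: cvg_fst.
    exact: itv_val_continuous.
  by move=> z /clamp_half[h1 h2]; rewrite addr0 h1 h2 (Hu _).2 (Ku _).1.
- by move=> t; rewrite /= /path_cat addr0 H0 K0.
- by move=> t; rewrite /= /path_cat addr0 H1 K1.
- move=> u /=; rewrite val_zero val_one invr_ge0 ler0n mulr0 addr0.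
  rewrite (Hu _).1 ifF; last by apply/negbTE; rewrite -ltNge; lra.
  by split=> //; rewrite -[RHS](Ku u).2; congr (K (clamp _, _)); lra.
Qed.

Lemma homotopic_rev p q :
  homotopic p q -> homotopic (loop_rev p) (loop_rev q).
Proof.
move=> [H [cH H0 H1 Hu]].
exists (fun z : I * I => H (clamp (1 - set_val z.1), z.2)); split => /=.
- move=> z; apply: (@continuous_comp _ _ _
    (fun z : I * I => (clamp (1 - set_val z.1) : I, z.2)) H); last exact: cH.
  apply: (@cvg_pair _ _ _ _ (nbhs (clamp (1 - set_val z.1) : I)) (nbhs z.2));
    last exact: cvg_snd.
  apply: (@continuous_comp _ _ _ fst (fun u : I => clamp (1 - set_val u) : I)).
    exact: cvg_fst.
  exact: (@path_rev_continuous R I idfun (fun=> cvg_id)).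
- by move=> t; rewrite H0.
- by move=> t; rewrite H1.
- move=> u; rewrite val_zero val_one subr0 subrr.
  by split; [exact: (Hu u).2|exact: (Hu u).1].
Qed.

Lemma loop_catA p q r :
  homotopic (loop_cat p (loop_cat q r)) (loop_cat (loop_cat p q) r).
Proof.
pose phi (t : I) : I := clamp (Num.min (2 * set_val t + 0)
  (Num.min (1 * set_val t + 4^-1) (2^-1 * set_val t + 2^-1))).
have aff (a b : R) : continuous (fun t : I => a * set_val t + b).
  move=> t; apply: (@continuousD R R I (fun t => a * set_val t) (cst b));
    last exact: cst_continuous.
  apply: (@continuousM R I (cst a) set_val); first exact: cst_continuous.
  exact: itv_val_continuous.
have cphi : continuous phi.
  move=> t; apply: continuous_comp; last exact: clamp_continuous.
  apply: (@continuous_min R I (fun t => 2 * set_val t + 0)); first exact: aff.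
  by apply: (@continuous_min R I (fun t => 1 * set_val t + 4^-1)); exact: aff.
apply: homotopic_sym.
apply: (@homotopic_reparam (loop_cat p (loop_cat q r)) phi idfun) => //.
- exact: cts_fun.
- by move=> t; exact: cvg_id.
- rewrite /phi val_zero; congr (clamp _).
  by rewrite min_l; [lra|rewrite le_min; apply/andP; split; lra].
- rewrite /phi val_one; congr (clamp _).
  by rewrite !min_r//; lra.
move=> t; have /andP[t0 t1] := unit_interval_bound t.
have cE (s : R) : 0 <= s -> s <= 1 -> set_val (clamp s) = s.
  by move=> s0 s1; rewrite clampE max_r// min_r.
change (path_cat (path_cat p q) r t = path_cat p (path_cat q r) (phi t)).
rewrite /path_cat /phi.
have [t4|t4] := leP (set_val t) (4^-1 : R).
  rewrite min_l; last by rewrite le_min; apply/andP; split; lra.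
  rewrite ifT; last by lra.
  rewrite cE; [|lra..]; rewrite ifT; last by lra.
  rewrite (cE (2 * _ + 0)); [|lra..]; rewrite ifT; last by lra.
  by congr (p (clamp _)); lra.
have [t2|t2] := leP (set_val t) (2^-1 : R).
  rewrite min_r; last by rewrite ge_min; apply/orP; left; lra.
  rewrite min_l; last by lra.
  rewrite cE; [|lra..]; rewrite ifF; last by apply/negbTE; rewrite -ltNge; lra.
  rewrite (cE (1 * _ + _)); [|lra..].
  rewrite ifF; last by apply/negbTE; rewrite -ltNge; lra.
  rewrite cE; [|lra..]; rewrite ifT; last by lra.
  by congr (q (clamp _)); lra.
rewrite min_r; last by rewrite ge_min; apply/orP; left; lra.
rewrite min_r; last by lra.
rewrite (cE (2^-1 * _ + _)); [|lra..].
rewrite ifF; last by apply/negbTE; rewrite -ltNge; lra.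
rewrite cE; [|lra..].
rewrite ifF; last by apply/negbTE; rewrite -ltNge; lra.
by congr (r (clamp _)); lra.
Qed.

Lemma loop_cat_cstl p : homotopic (loop_cat loop_cst p) p.
Proof.
apply: (@homotopic_reparam p (fun t => clamp (2 * set_val t + -1)) idfun) => //.
- exact: cts_fun.
- exact: clamp_affine_continuous.
- by move=> t; exact: cvg_id.
- apply: val_inj; rewrite -![val _]/(set_val _) clampE val_zero.
  by rewrite max_l ?min_r//; lra.
- by rewrite val_one; congr (clamp _); lra.
move=> t; change (path_cat (cst x) p t = p (clamp (2 * set_val t + -1))).
rewrite /path_cat /=; case: ifPn => // t2.
rewrite (_ : clamp _ = zero) ?path_zero//; apply: val_inj.
rewrite -![val _]/(set_val _) clampE val_zero.
by rewrite max_l ?min_r//; lra.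
Qed.

Lemma loop_cat_cstr p : homotopic (loop_cat p loop_cst) p.
Proof.
apply: (@homotopic_reparam p (fun t => clamp (2 * set_val t + 0)) idfun) => //.
- exact: cts_fun.
- exact: clamp_affine_continuous.
- by move=> t; exact: cvg_id.
- by rewrite val_zero; congr (clamp _); lra.
- apply: val_inj; rewrite -![val _]/(set_val _) clampE val_one.
  by rewrite max_r ?min_l//; lra.
move=> t; change (path_cat p (cst x) t = p (clamp (2 * set_val t + 0))).
rewrite /path_cat /= addr0; case: ifPn => //; rewrite -ltNge => t2.
rewrite (_ : clamp _ = one) ?path_one//; apply: val_inj.
rewrite -![val _]/(set_val _) clampE val_one.
by rewrite max_r ?min_l//; lra.
Qed.

Lemma loop_catV p : homotopic (loop_cat p (loop_rev p)) loop_cst.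
Proof.
apply: (@homotopic_reparam p (path_cat idfun (path_rev idfun)) (cst zero)).
- exact: cts_fun.
- apply: path_cat_continuous => [t||]; first exact: cvg_id.
    by apply: path_rev_continuous => t; exact: cvg_id.
  by rewrite path_rev0.
- exact: cst_continuous.
- by rewrite path_cat0.
- by rewrite path_cat1 path_rev1.
- move=> t; change (path_cat p (path_rev p) t =
    p (path_cat idfun (path_rev idfun) t)).
  by rewrite /path_cat /path_rev /=; case: ifP.
- by move=> t /=; rewrite path_zero.
Qed.

Lemma loop_revK p : loop_rev (loop_rev p) = p.
Proof.
apply/path_eqP => t; have /andP[t0 t1] := unit_interval_bound t.
change (path_rev (path_rev p) t = p t).
rewrite /path_rev (_ : clamp _ = t)//.
rewrite -[RHS]clampK; congr clamp.
by rewrite clampE max_r ?min_r//; lra.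
Qed.

Definition homotopicb (p q : loop) : bool := `[< homotopic p q >].

Lemma homotopicb_refl : reflexive homotopicb.
Proof. by move=> p; exact/asboolP/homotopic_refl. Qed.

Lemma homotopicb_sym : symmetric homotopicb.
Proof.
move=> p q; apply/asboolP/asboolP; exact: homotopic_sym.
Qed.

Lemma homotopicb_trans : transitive homotopicb.
Proof.
by move=> q p r /asboolP pq /asboolP qr; apply/asboolP/(homotopic_trans pq).
Qed.

Definition homotopic_rel :=
  EquivRel homotopicb homotopicb_refl homotopicb_sym homotopicb_trans.

Definition pi1 := {eq_quot homotopic_rel}.
HB.instance Definition _ := Quotient.on pi1.
HB.instance Definition _ := Choice.on pi1.

Lemma pi1_eqP (p q : loop) :
  reflect (homotopic p q) (\pi_pi1 p == \pi_pi1 q).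
Proof. by rewrite eqmodE; exact: asboolP. Qed.

Lemma pi1_repr (p : loop) : homotopic p (repr (\pi_pi1 p)).
Proof. by apply/pi1_eqP; rewrite reprK. Qed.

Definition pi1_mul (a b : pi1) : pi1 := \pi_pi1 (loop_cat (repr a) (repr b)).
Definition pi1_inv (a : pi1) : pi1 := \pi_pi1 (loop_rev (repr a)).
Definition pi1_one : pi1 := \pi_pi1 loop_cst.

Lemma pi1_mulE (p q : loop) :
  pi1_mul (\pi_pi1 p) (\pi_pi1 q) = \pi_pi1 (loop_cat p q).
Proof.
by apply/eqP/pi1_eqP/homotopic_cat; apply/homotopic_sym/pi1_repr.
Qed.

Lemma pi1_invE (p : loop) : pi1_inv (\pi_pi1 p) = \pi_pi1 (loop_rev p).
Proof. by apply/eqP/pi1_eqP/homotopic_rev/homotopic_sym/pi1_repr. Qed.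

Lemma pi1_mulA : associative pi1_mul.
Proof.
elim/quotW=> p; elim/quotW=> q; elim/quotW=> r.
rewrite (pi1_mulE q r) (pi1_mulE p q) (pi1_mulE p (loop_cat q r)).
rewrite (pi1_mulE (loop_cat p q) r).
exact/eqP/pi1_eqP/loop_catA.
Qed.

Lemma pi1_mul1g : left_id pi1_one pi1_mul.
Proof.
elim/quotW=> p; rewrite (pi1_mulE loop_cst p); exact/eqP/pi1_eqP/loop_cat_cstl.
Qed.

Lemma pi1_mulg1 : right_id pi1_one pi1_mul.
Proof.
elim/quotW=> p; rewrite (pi1_mulE p loop_cst); exact/eqP/pi1_eqP/loop_cat_cstr.
Qed.

Lemma pi1_mulgV : right_inverse pi1_one pi1_inv pi1_mul.
Proof.
elim/quotW=> p; rewrite (pi1_invE p) (pi1_mulE p (loop_rev p)); exact/eqP/pi1_eqP/loop_catV.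
Qed.

Lemma pi1_mulVg : left_inverse pi1_one pi1_inv pi1_mul.
Proof.
elim/quotW=> p; rewrite (pi1_invE p) (pi1_mulE (loop_rev p) p) -{2}(loop_revK p).
exact/eqP/pi1_eqP/loop_catV.
Qed.

HB.instance Definition _ := isGroup.Build pi1
  pi1_mulA pi1_mul1g pi1_mulg1 pi1_mulVg pi1_mulgV.

End fundamental_group.

Arguments loop R {X} x.
Arguments pi1 : clear implicits.

Section induced_map.
Context {R : realType} {Y X : topologicalType} (f : continuousType Y X) (y : Y).

Definition loop_map (p : loop R y) : loop R (f y) :=
  [the {path (unit_interval R) from (f y) to (f y) in X} of f \o p].

Definition pi1_map (a : pi1 R Y y) : pi1 R X (f y) :=
  \pi_(pi1 R X (f y)) (loop_map (repr a)).

Lemma pi1_mapE (p : loop R y) : pi1_map (\pi_(pi1 R Y y) p) = \pi_(pi1 R X (f y)) (loop_map p).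
Proof.
apply/eqP/pi1_eqP; have [H [cH H0 H1 Hu]] := homotopic_sym (pi1_repr p).
exists (f \o H); split=> /=.
- by move=> z; apply: continuous_comp; [exact: cH|exact: cts_fun].
- by move=> t; rewrite H0.
- by move=> t; rewrite H1.
- by move=> u; rewrite (Hu u).1 (Hu u).2.
Qed.

Lemma pi1_mapM : {morph pi1_map : a b / (a * b)%g}.
Proof.
elim/quotW=> p; elim/quotW=> q; rewrite (pi1_mapE p) (pi1_mapE q).
change (pi1_map (pi1_mul (\pi_(pi1 R Y y) p) (\pi_(pi1 R Y y) q)) =
  pi1_mul (\pi_(pi1 R X (f y)) (loop_map p)) (\pi_(pi1 R X (f y)) (loop_map q))).
rewrite (pi1_mulE p q) (pi1_mulE (loop_map p) (loop_map q)) pi1_mapE; congr (\pi_(pi1 R X (f y)) _); apply/path_eqP => t.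
change (f (path_cat p q t) = path_cat (f \o p) (f \o q) t).
by rewrite /path_cat; case: ifP.
Qed.

HB.instance Definition _ := isMultiplicative.Build _ _ pi1_map pi1_mapM.

End induced_map.

Section cw_complex.
Context {R : realType}.

Definition disk k : set 'rV[R]_k := [set v | \sum_i v 0 i ^+ 2 <= 1].
Definition open_disk k : set 'rV[R]_k := [set v | \sum_i v 0 i ^+ 2 < 1].
Definition sphere k : set 'rV[R]_k := [set v | \sum_i v 0 i ^+ 2 = 1].

Arguments disk k : clear implicits.
Arguments open_disk k : clear implicits.
Arguments sphere k : clear implicits.

(* The characteristic maps are only meaningful on the closed disks; their values
   elsewhere are irrelevant. *)
Record cw_structure (X : topologicalType) := CWStructure {
  cw_cell : Type;
  cw_dim : cw_cell -> nat;
  cw_char : forall c, 'rV[R]_(cw_dim c) -> X;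
  open_cell := fun c => cw_char (c := c) @` open_disk (cw_dim c);
  cw_char_continuous : forall c,
    {within disk (cw_dim c), continuous (cw_char (c := c))};
  cw_char_homeo : forall c, exists g : X -> 'rV[R]_(cw_dim c),
    {within open_cell c, continuous g} /\
    (forall v, open_disk (cw_dim c) v -> g (cw_char v) = v);
  cw_disjoint : trivIset [set: cw_cell] open_cell;
  cw_cover : \bigcup_c open_cell c = [set: X];
  cw_closure_finite : forall c, exists S : set cw_cell,
    [/\ finite_set S, (forall b, S b -> (cw_dim b < cw_dim c)%N) &
      cw_char (c := c) @` sphere (cw_dim c) `<=` \bigcup_(b in S) open_cell b];
  cw_weak_topology : forall A : set X,
    closed A <-> forall c, closed (disk (cw_dim c) `&` cw_char (c := c) @^-1` A)
}.

Definition is_cw_complex (X : topologicalType) : Prop :=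
  hausdorff_space X /\ inhabited (cw_structure X).

End cw_complex.

Section coverings.
Context {E X : topologicalType}.

Definition evenly_covered (q : E -> X) (U : set X) : Prop :=
  exists F : set (set E),
    [/\ forall V, F V -> open V,
        trivIset F id,
        q @^-1` U = \bigcup_(V in F) V &
        forall V, F V -> exists s : X -> E,
          [/\ {within U, continuous s},
              forall x, U x -> V (s x) /\ q (s x) = x &
              forall e, V e -> s (q e) = e]].

Definition is_covering (q : E -> X) : Prop :=
  continuous q /\
  forall x, exists U : set X, [/\ open U, U x & evenly_covered q U].

End coverings.

Definition path_connected (R : realType) (X : topologicalType) : Prop :=
  forall x y : X, inhabited {path (unit_interval R) from x to y in X}.

Definition simply_connected (R : realType) (X : topologicalType) : Prop :=
  [/\ [set: X] !=set0, path_connected R X &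
      forall (x : X) (a : pi1 R X x), a = 1%g].

Definition is_universal_covering (R : realType) (E X : topologicalType)
    (q : E -> X) : Prop :=
  is_covering q /\ simply_connected R E.

Section weak_convergence.
Context (R : realType) (Z : ptopologicalType).

Definition borel := g_sigma_algebraType (@open Z).
HB.instance Definition _ := Measurable.on borel.

Definition borel_probability := probability borel R.

Definition bounded_continuous : set (Z -> R) :=
  [set phi | continuous phi /\ bounded_fun phi].

Definition integrate_test (mu : borel_probability) :
    {ptws set_type bounded_continuous -> R} :=
  fun phi => \int[mu]_z (set_val phi z).

HB.instance Definition _ := Choice.on borel_probability.
HB.instance Definition _ := Topological.copy borel_probability
  (initial_topology integrate_test).

Definition supp (mu : borel_probability) : set Z :=
  [set z | forall U : set Z, open U -> U z -> (0 < mu U)%E].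

(* The identity is required on all sets rather than on Borel sets only because
   measures of the library are functions on all sets: this way a formal sum
   determines its measure. *)
Definition finitely_supported (n : nat) : set borel_probability :=
  [set mu : borel_probability | exists (z : 'I_n -> Z) (a : 'I_n -> R),
    [/\ forall i, 0 <= a i, \sum_i a i = 1 &
        forall A : set borel, mu A = (\sum_i (a i)%:E * \d_(z i : borel) A)%E]].

End weak_convergence.

Section fiberwise_measures.
Context (R : realType) (E : ptopologicalType) (B : topologicalType).
Variables (n : nat) (f : E -> B).

Definition fiberwise_set : set (borel_probability R E) :=
  [set mu | finitely_supported n mu /\
            exists b, supp mu `<=` f @^-1` [set b]].

Definition fiberwise_measures := set_type fiberwise_set.
HB.instance Definition _ := Topological.copy fiberwise_measures
  (set_type fiberwise_set).

Definition fiberwise_map (mu : fiberwise_measures) : B :=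
  projT1 (cid (proj2 (set_valP mu))).

Definition has_section : Prop :=
  exists s : B -> fiberwise_measures,
    continuous s /\ forall b, fiberwise_map (s b) = b.

End fiberwise_measures.

(* The universal covering of a connected CW complex exists and is unique up to
   isomorphism over X, hence the existential quantifier; the infimum of an empty
   set is +oo. *)
Definition dcat1 (R : realType) (X : topologicalType) : \bar R :=
  ereal_inf [set n%:R%:E | n in
    [set n | exists (E : ptopologicalType) (q : E -> X),
       is_universal_covering R q /\ has_section R n.+1 q]].

(* Main.v *)
(* Let q : E -> X be a universal covering with a section s of q_n.  The pullback
   P = {(y, e) | f y = q e} is a covering of Y.  A loop in P is null-homotopic
   because its image in E is, hence so is its image in Y by injectivity of f on
   fundamental groups, and such a null-homotopy lifts; surjectivity connects the
   points of a fibre of P.  Thus P is universal, and y |-> the copy of s (f y) in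
   the fibre of P over y is a section.

   Its continuity is where X being a CW complex matters: weak convergence of
   s (f y) is only informative when E carries enough continuous functions.  A
   function that is constant on each sheet over an evenly covered U, multiplied
   by a bump function of X supported in U, is such a test function.  Testing
   against the indicator of the sheets that meet the support of s (f y0) shows
   that the mass leaving these sheets tends to 0; freezing a test function phi of
   P at its values on the fibre over y0 then compares the integrals of phi. *)

Require Import Defs.
From HB Require Import structures.
From mathcomp Require Import all_boot all_order all_algebra.
From mathcomp Require Import generic_quotient lra ring.
From mathcomp Require Import all_classical all_reals all_analysis.
From mathcomp Require Import homotopy measurable_realfun zify.

Set Implicit Arguments.
Unset Strict Implicit.
Unset Printing Implicit Defensive.

Import Order.TTheory GRing.Theory Num.Theory.
Import numFieldNormedType.Exports.

Local Open Scope classical_set_scope.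
Local Open Scope quotient_scope.
Local Open Scope ring_scope.

(** * Lifting along coverings *)

Lemma pair_continuous (S T U : topologicalType) (f : S -> T) (g : S -> U) :
  continuous f -> continuous g -> continuous (fun x => (f x, g x)).
Proof.
move=> cf cg x; apply: (@cvg_pair _ _ _ _ (nbhs (f x)) (nbhs (g x))).
- exact: cf.
- exact: cg.
Qed.

Lemma continuous_subspace_comp (S T U : topologicalType) (A : set S) (B : set T)
    (f : S -> T) (g : T -> U) :
  {within A, continuous f} -> f @` A `<=` B -> {within B, continuous g} ->
  {within A, continuous (g \o f)}.
Proof.
move=> cf fAB cg; apply/subspace_continuousP => x Ax W gW.
have Bfx : B (f x) by apply: fAB; exists x.
have /subspace_continuousP/(_ _ Bfx)/(_ W gW) W1 := cg.
have /subspace_continuousP/(_ _ Ax)/(_ _ W1) W2 := cf.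
change (\near x, A x -> W (g (f x))).
near=> t => At; have : A t -> B (f t) -> W (g (f t)) by near: t.
by apply => //; apply: fAB; exists t.
Unshelve. all: by end_near. Qed.

Section covering_lifts.
Context {T E X : topologicalType} (q : E -> X).
Hypothesis cov_q : is_covering q.

Lemma sheet_eq (F : set (set E)) (V W : set E) e :
  trivIset F id -> F V -> F W -> V e -> W e -> V = W.
Proof. by move=> tF FV FW Ve We; apply: tF => //; exists e. Qed.

(** The set where [K] and [L] agree is clopen in [S]. Near any point the sheets through [K t] and
    [L t] are either equal, and then [q] is injective on the common sheet, or disjoint, and then the
    two lifts differ nearby. *)
Lemma unique_lift (S : set T) (K L : T -> E) (z : T) :
  connected S -> {within S, continuous K} -> {within S, continuous L} ->
  (forall t, S t -> q (K t) = q (L t)) -> S z -> K z = L z ->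
  forall t, S t -> K t = L t.
Proof.
move=> connS cK cL qKL Sz KLz.
pose U : set (subspace S) := S `&` [set t | K t = L t].
suff -> : S = U by move=> t [].
have sheets t : S t -> exists V W : set E,
   [/\ open V, open W, V (K t), W (L t) &
    (forall u, S u -> V (K u) -> W (L u) -> K u = L u) \/ V `&` W = set0].
  move=> St; have [_ /(_ (q (K t))) [N [oN Nt [F [oF tF NE Fs]]]]] := cov_q.
  have [V FV VK] : (\bigcup_(V in F) V) (K t) by rewrite -NE.
  have [W FW WL] : (\bigcup_(V in F) V) (L t) by rewrite -NE/= -qKL.
  exists V, W; split=> //; [exact: oF|exact: oF|].
  have [VW|VW] := pselect (V = W).
    left => u Su; rewrite VW => WK WLu; have [s [_ _ sq]] := Fs _ FW.
    by rewrite -(sq _ WK) -(sq _ WLu) qKL.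
  right; rewrite -subset0 => e [Ve We].
  by apply: VW; exact: (sheet_eq tF FV FW Ve We).
have nearS t (V W : set E) : S t -> open V -> open W -> V (K t) -> W (L t) ->
    nbhs (t : subspace S) [set u | [/\ S u, V (K u) & W (L u)]].
  move=> St oV oW VK WL; near=> u; split.
  - near: u; apply: open_nbhs_nbhs; split => //; exact: open_subspaceT.
  - by near: u; apply: (cK t V); exact: open_nbhs_nbhs.
  - by near: u; apply: (cL t W); exact: open_nbhs_nbhs.
apply/esym; move/clopen_connectedP : connS; apply; last 2 first.
- exact: subIsetl.
- by exists z.
split.
- rewrite openE => t [St KLt].
  have [V [W [oV oW VK WL [VW|VW0]]]] := sheets t St; last first.
    by exfalso; rewrite -[False]/(set0 (K t)) -VW0; split => //; rewrite KLt.
  apply: filterS (nearS t V W St oV oW VK WL) => u [Su Vu Wu].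
  by split=> //; exact: VW.
- rewrite -openC openE => t nUt; have [St|St] := pselect (S t); last first.
    have : nbhs (t : subspace S) (~` S).
      apply: open_nbhs_nbhs; split => //; apply: closed_openC.
      exact: closed_subspaceT.
    by apply: filterS => u Su [].
  have KLt : K t <> L t by move=> KLt; apply: nUt.
  have [V [W [oV oW VK WL [VW|VW0]]]] := sheets t St.
    by case: KLt; exact: VW.
  apply: filterS (nearS t V W St oV oW VK WL) => u [Su Vu Wu] [_ KLu].
  by rewrite -[False]/(set0 (K u)) -VW0; split => //; rewrite KLu.
Unshelve. all: by end_near. Qed.

(** Every starting point [z] and every [e] above [h z] are allowed, so that a second piece can be
    lifted from the value that the first lift has reached. *)
Definition liftable (h : T -> X) (S : set T) := forall z e, S z -> q e = h z ->
  exists K : T -> E, [/\ {within S, continuous K},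
    forall t, S t -> q (K t) = h t & K z = e].

Lemma liftable_evenly_covered (h : T -> X) (S : set T) (U : set X) :
  continuous h -> evenly_covered q U -> h @` S `<=` U -> liftable h S.
Proof.
move=> ch [F [oF tF UE Fs]] hSU z e Sz qe.
have Uhz : U (h z) by apply: hSU; exists z.
have [V FV Ve] : (\bigcup_(V in F) V) e by rewrite -UE/= qe.
have [s [cs sU sV]] := Fs _ FV.
exists (s \o h); split => /=.
- by apply: continuous_subspace_comp hSU cs; exact: continuous_subspaceT.
- by move=> t St; apply: (sU _ _).2; apply: hSU; exists t.
- by rewrite -qe sV.
Qed.

(** Lift over one piece, then lift over the other from the value at a common point [w]. Both lifts
    agree on the connected intersection by [unique_lift], and they glue continuously because the
    pieces are closed. *)
Lemma liftable_setU (h : T -> X) (A B : set T) :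
  closed A -> closed B -> connected (A `&` B) -> A `&` B !=set0 ->
  liftable h A -> liftable h B -> liftable h (A `|` B).
Proof.
move=> cA cB.
wlog suff : A B cA cB / connected (A `&` B) -> A `&` B !=set0 ->
  liftable h A -> liftable h B -> forall z e, A z -> q e = h z ->
  exists K : T -> E, [/\ {within A `|` B, continuous K},
    forall t, (A `|` B) t -> q (K t) = h t & K z = e].
  move=> wh connAB AB0 lA lB z e [Az|Bz] qe; first exact: (wh A B).
  by rewrite setUC; apply: (wh B A) => //; rewrite setIC.
move=> connAB [w [Aw Bw]] lA lB z e Az qe.
have [K [cK qK Kz]] := lA z e Az qe.
have [L [cL qL Lw]] := lB w (K w) Bw (qK w Aw).
have KL t : A t -> B t -> K t = L t.
  move=> At Bt; apply: (unique_lift connAB _ _ _ (conj Aw Bw)) (conj At Bt) => //.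
  - exact: continuous_subspaceW cK.
  - exact: continuous_subspaceW cL.
  - by move=> u [Au Bu]; rewrite qK// qL.

pose M t := if t \in A then K t else L t.
have MK t : A t -> M t = K t by move=> At; rewrite /M mem_set.
have ML t : B t -> M t = L t.
  by move=> Bt; rewrite /M; case: ifPn => // /set_mem At; exact: KL.
exists M; split.
- apply: withinU_continuous => //.
    by apply: subspace_eq_continuous cK => t /set_mem At; rewrite /from_subspace MK.
  by apply: subspace_eq_continuous cL => t /set_mem At; rewrite /from_subspace ML.
- by move=> t [At|Bt]; [rewrite MK// qK|rewrite ML// qL].
- by rewrite MK.
Qed.

End covering_lifts.

(** * Lifting maps of a square by dyadic subdivision *)

Section square_lift.
Context {R : realType} {E X : topologicalType} (q : E -> X).
Hypothesis cov_q : is_covering q.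
Local Notation I := (unit_interval R).

(** Rectangles live in the plane rather than in [I * I], so that subdividing them is affine
    arithmetic without clamping. *)
Definition rectangle (a c b d : R) : set (R * R) :=
  [set z | a <= z.1 <= c /\ b <= z.2 <= d].

Lemma rectangle_closed a c b d : closed (rectangle a c b d).
Proof.
have cl (p : R * R -> R) (u v : R) : continuous p ->
    closed [set z | u <= p z <= v].
  move=> cp; have -> : [set z | u <= p z <= v] = p @^-1` `[u, v].
    by apply/seteqP; split => z /=; rewrite in_itv.
  by apply: preimage_closed => //; exact: interval_closed.
by apply: closedI; apply: cl => z; [exact: cvg_fst|exact: cvg_snd].
Qed.

Lemma rectangle_splitl a m c b d : a <= m -> m <= c ->
  rectangle a m b d `|` rectangle m c b d = rectangle a c b d.
Proof.
move=> am mc; apply/seteqP; split => [z [|] [/andP[? ?] ?]|z [/andP[z1 z2] z3]].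
- by split => //; apply/andP; split => //; lra.
- by split => //; apply/andP; split => //; lra.
by have [?|/ltW ?] := leP z.1 m; [left|right]; split => //; apply/andP; split.
Qed.

Lemma rectangle_splitr a c b m d : b <= m -> m <= d ->
  rectangle a c b m `|` rectangle a c m d = rectangle a c b d.
Proof.
move=> am mc; apply/seteqP; split => [z [|] [? /andP[? ?]]|z [z3 /andP[z1 z2]]].
- by split => //; apply/andP; split => //; lra.
- by split => //; apply/andP; split => //; lra.
by have [?|/ltW ?] := leP z.2 m; [left|right]; split => //; apply/andP; split.
Qed.

Lemma vertical_connected m b d : connected (rectangle m m b d).
Proof.
have -> : rectangle m m b d = pair m @` `[b, d].
  apply/seteqP; split => [[x y] [/= /andP[x1 x2] y12]|_ [y /= y12 <-]].
    by exists y => /=; [rewrite in_itv|congr pair; lra].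
  by split => /=; [rewrite lexx|move: y12; rewrite in_itv].
apply: connected_continuous_connected; first exact: segment_connected.
apply/continuous_subspaceT/pair_continuous => y; [exact: cvg_cst|exact: cvg_id].
Qed.

Lemma horizontal_connected a c m : connected (rectangle a c m m).
Proof.
have -> : rectangle a c m m = (fun x => (x, m)) @` `[a, c].
  apply/seteqP; split => [[x y] [/= y12 /andP[x1 x2]]|_ [y /= y12 <-]].
    by exists x => /=; [rewrite in_itv|congr pair; lra].
  by split => /=; [move: y12; rewrite in_itv|rewrite lexx].
apply: connected_continuous_connected; first exact: segment_connected.
apply/continuous_subspaceT/pair_continuous => y; [exact: cvg_id|exact: cst_continuous].
Qed.

Variable h : R * R -> X.
Hypothesis ch : continuous h.

(** Two squares of side [r] are glued along a vertical segment to form a row, then two rows along a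
    horizontal segment; both segments are connected, as [liftable_setU] requires. *)
Lemma liftable_double (a b r : R) : 0 <= r ->
  (forall u v, a <= u -> u + r <= a + 2 * r -> b <= v -> v + r <= b + 2 * r ->
    liftable q h (rectangle u (u + r) v (v + r))) ->
  liftable q h (rectangle a (a + 2 * r) b (b + 2 * r)).
Proof.
move=> r0 lr.
have row v : b <= v -> v + r <= b + 2 * r ->
    liftable q h (rectangle a (a + 2 * r) v (v + r)).
  move=> bv vb; rewrite -(@rectangle_splitl a (a + r)); [|lra..].
  rewrite (_ : a + 2 * r = (a + r) + r); last lra.
  have IE : rectangle a (a + r) v (v + r) `&`
            rectangle (a + r) (a + r + r) v (v + r) =
            rectangle (a + r) (a + r) v (v + r).
    apply/seteqP; split => z [].
      by move=> [/andP[? ?] ?] [/andP[? ?] _]; split => //; apply/andP; split.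
    by move=> /andP[? ?] ?; split; split => //; apply/andP; split => //; lra.
  apply: liftable_setU => //; rewrite ?IE; do ?exact: rectangle_closed.
  - exact: vertical_connected.
  - by exists (a + r, v); split => /=; apply/andP; split; lra.
  - by apply: lr; lra.
  - by apply: lr; lra.
rewrite -(@rectangle_splitr _ _ b (b + r)); [|lra..].
rewrite (_ : b + 2 * r = (b + r) + r); last lra.
have IE : rectangle a (a + 2 * r) b (b + r) `&`
          rectangle a (a + 2 * r) (b + r) (b + r + r) =
          rectangle a (a + 2 * r) (b + r) (b + r).
  apply/seteqP; split => z [].
    by move=> [? /andP[? ?]] [_ /andP[? ?]]; split => //; apply/andP; split.
  by move=> ? /andP[? ?]; split; split => //; apply/andP; split => //; lra.
apply: liftable_setU => //; rewrite ?IE; do ?exact: rectangle_closed.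
- exact: horizontal_connected.
- by exists (a, b + r); split => /=; apply/andP; split; lra.
- by apply: row; lra.
- by apply: row; lra.
Qed.

(** A Lebesgue number argument, phrased as a near-covering: compactness of the set of lower left
    corners yields one dyadic side that works for all of them. *)
Lemma liftable_small (a b : R) :
  exists n, forall u v, a <= u <= a + 1 -> b <= v <= b + 1 ->
    liftable q h (rectangle u (u + (2 ^+ n)^-1) v (v + (2 ^+ n)^-1)).
Proof.
have cpt : compact (`[a, a + 1] `*` `[b, b + 1]).
  by apply: compact_setX; exact: segment_compact.
move/compact_near_coveringP : cpt => /(_ nat \oo
  (fun n z => liftable q h (rectangle z.1 (z.1 + (2 ^+ n)^-1)
                                      z.2 (z.2 + (2 ^+ n)^-1)))).
case.
  move=> z _; have [_ /(_ (h z)) [U [oU Uz evU]]] := cov_q.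
  have : nbhs z (h @^-1` U) by apply: ch; exact: open_nbhs_nbhs.
  move=> /nbhs_ballP[e /= e0 eU].
  (* Half of the radius is spent on moving the corner, the other half on the side of the square. *)
  have e20 : 0 < e / 2 by rewrite divr_gt0.
  near=> w n.
  apply: (liftable_evenly_covered ch evU) => _ [t [t1 t2] <-]; apply: eU.
  have ne : (2 ^+ n)^-1 < e / 2.
    near: n; have := near_infty_natSinv_expn_lt (PosNum e20).
    by apply: filterS => n; rewrite div1r.
  have [] : ball z (e / 2) w by near: w; exact: nbhsx_ballx.
  rewrite /ball /= /ball_ !ltr_norml => /andP[? ?] /andP[? ?].
  by split; rewrite /ball /= /ball_ !ltr_norml; apply/andP; split; lra.
move=> n _ /(_ n (leqnn n)) nP; exists n => u v uP vP.
by apply: (nP (u, v)); split; rewrite /= in_itv.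
Unshelve. all: by end_near. Qed.

Lemma liftable_unit_square : liftable q h (rectangle 0 1 0 1).
Proof.
have [n lifn] := liftable_small 0 0.
suff H k : (k <= n)%N -> forall u v : R, 0 <= u -> u + (2 ^+ k)^-1 <= 1 ->
    0 <= v -> v + (2 ^+ k)^-1 <= 1 ->
    liftable q h (rectangle u (u + (2 ^+ k)^-1) v (v + (2 ^+ k)^-1)).
  by have := H 0%N (leq0n n) 0 0; rewrite expr0 invr1 !add0r; apply.
(* Induction on [n - k]: from the small squares at level [n], each step doubles the side, until the
   unit square at level 0. *)
move=> kn; rewrite -(subKn kn); elim: (n - k)%N => [|j ih] u v u0 u1 v0 v1.
  move: u1 v1; rewrite subn0 => u1 v1.
  have p0 : 0 < (2 ^+ n : R)^-1 by rewrite invr_gt0 exprn_gt0.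
  by apply: lifn; apply/andP; split; lra.
(* Once [n <= j], truncated subtraction keeps the level at 0 and the induction hypothesis already is
   the claim. *)
have [jn|jn] := leqP n j.
  have e : (n - j.+1 = n - j)%N by lia.
  by move: u1 v1; rewrite e => u1 v1; exact: ih.
have e : (2 ^+ (n - j.+1) : R)^-1 = 2 * (2 ^+ (n - j))^-1.
  rewrite -[in RHS](subnSK jn) exprS invfM mulrA divff ?mul1r//.
rewrite e; apply: liftable_double => [|u' v' *].
  by rewrite invr_ge0 exprn_ge0.
by move: u1 v1; rewrite e => u1 v1; apply: ih; lra.
Qed.

End square_lift.

(** * Lifting squares and paths from the unit interval *)

Section path_lift.
Context {R : realType} {E X : topologicalType} (q : E -> X).
Hypothesis cov_q : is_covering q.
Local Notation I := (unit_interval R).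

Lemma square_lift (H : I * I -> X) (e : E) : continuous H -> q e = H (zero, zero) ->
  exists K : I * I -> E,
    [/\ continuous K, forall z, q (K z) = H z & K (zero, zero) = e].
Proof.
move=> cH qe.
(* Clamping extends [H] to the whole plane, where the subdivision argument applies. *)
pose h (z : R * R) := H (clamp z.1, clamp z.2).
have ch : continuous h.
  move=> z; apply: (@continuous_comp _ _ _ (fun z : R * R => (clamp z.1 : I, clamp z.2 : I)) H);
    last exact: cH.
  move: z; apply: pair_continuous => z.
    by apply: (@continuous_comp _ _ _ fst clamp); [exact: cvg_fst|exact: clamp_continuous].
  by apply: (@continuous_comp _ _ _ snd clamp); [exact: cvg_snd|exact: clamp_continuous].
have [||K [cK qK K0]] := liftable_unit_square cov_q ch (z := (0, 0)) (e := e).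
- by split => /=; rewrite lexx ler01.
- exact: qe.
pose v (z : I * I) : R * R := (set_val z.1, set_val z.2).
have vS z : rectangle 0 1 0 1 (v z).
  by split; exact: unit_interval_bound.
have cv : continuous v.
  apply: pair_continuous => z.
    by apply: (@continuous_comp _ _ _ fst set_val); [exact: cvg_fst|exact: itv_val_continuous].
  by apply: (@continuous_comp _ _ _ snd set_val); [exact: cvg_snd|exact: itv_val_continuous].
exists (K \o v); split.
- have : {within setT, continuous (K \o v)}.
    apply: continuous_subspace_comp cK; first exact: continuous_subspaceT.
    by move=> _ [z _ <-]; exact: vS.
  by move=> cKv; apply/continuous_subspace_setT.
- by move=> z /=; rewrite qK; [rewrite /h/= !clampK; case: z|exact: vS].
- by rewrite /= /v /= !val_zero.
Qed.

Lemma unit_interval_connected : connected [set: I].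
Proof.
have -> : [set: I] = clamp @` `[0, 1].
  apply/seteqP; split => [t _|//]; exists (set_val t); last exact: clampK.
  by rewrite /= in_itv; exact: unit_interval_bound.
apply: connected_continuous_connected; first exact: segment_connected.
by apply: continuous_subspaceT; exact: clamp_continuous.
Qed.

(** A path is treated as a square that is constant in its second coordinate. *)
Lemma path_lift (p : I -> X) (e : E) : continuous p -> q e = p zero ->
  exists l : I -> E, [/\ continuous l, forall t, q (l t) = p t & l zero = e].
Proof.
move=> cp qe; have [||K [cK qK K0]] := @square_lift (p \o fst) e.
- by move=> z; apply: continuous_comp; [exact: cvg_fst|exact: cp].
- exact: qe.
exists (fun t => K (t, zero)); split => //.
  move=> t; apply: (@continuous_comp _ _ _ (fun t => (t, zero : I)) K); last exact: cK.
  by move: t; apply: pair_continuous => t; [exact: cvg_id|exact: cst_continuous].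
Qed.

Lemma unique_path_lift (k l : I -> E) : continuous k -> continuous l ->
  (forall t, q (k t) = q (l t)) -> k zero = l zero -> k =1 l.
Proof.
move=> ck cl qkl kl0 t.
apply: (unique_lift cov_q unit_interval_connected _ _ _ (z := zero)) => //.
- exact: continuous_subspaceT.
- exact: continuous_subspaceT.
Qed.

End path_lift.

(** * Change of base point *)

Section base_point_change.
Context {R : realType} {X : topologicalType}.
Local Notation I := (unit_interval R).

Lemma set_val_clamp (s : R) : 0 <= s -> s <= 1 -> set_val (clamp s) = s.
Proof. by move=> s0 s1; rewrite clampE max_r// min_r. Qed.

Lemma clamp_zero (s : R) : s <= 0 -> clamp s = zero :> I.
Proof.
move=> s0; apply: val_inj; rewrite -![val _]/(set_val _) !clampE maxxx.
by rewrite max_l// min_r.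
Qed.

Lemma clamp_one (s : R) : 1 <= s -> clamp s = one :> I.
Proof.
move=> s1; apply: val_inj; rewrite -![val _]/(set_val _) !clampE.
by rewrite !max_r ?min_l//; lra.
Qed.

Lemma continuous_convex (Z : topologicalType) (w a b : Z -> I) :
  continuous w -> continuous a -> continuous b ->
  continuous (fun z => clamp ((1 - set_val (w z)) * set_val (a z) +
                              set_val (w z) * set_val (b z)) : I).
Proof.
move=> cw ca cb z; apply: continuous_comp; last exact: clamp_continuous.
have cv (h : Z -> I) : continuous h ->
    {for z, continuous (fun z => set_val (h z) : R)}.
  by move=> ch; apply: continuous_comp; [exact: ch|exact: itv_val_continuous].
apply: (@continuousD R R Z (fun z => (1 - set_val (w z)) * set_val (a z))
  (fun z => set_val (w z) * set_val (b z))).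
  apply: (@continuousM R Z (fun z => 1 - set_val (w z)) (fun z => set_val (a z))).
    apply: (@continuousB R R Z (cst 1) (fun z => set_val (w z))); last exact: cv.
    exact: cst_continuous.
  exact: cv.
by apply: (@continuousM R Z (fun z => set_val (w z)) (fun z => set_val (b z)));
  exact: cv.
Qed.

(** The square is convex, so [s] and [t] are joined by a straight-line homotopy fixing their common
    endpoints; [H] carries it to [X]. *)
Lemma homotopic_in_square (x : X) (H : I * I -> X) (s t : I -> I * I)
    (p q : loop R x) :
  continuous H -> continuous s -> continuous t ->
  s zero = t zero -> s one = t one ->
  p =1 H \o s -> q =1 H \o t -> homotopic p q.
Proof.
move=> cH cs ct e0 e1 pE qE.
have c1 (r : I -> I * I) : continuous r -> continuous (fun z : I * I => (r z.1).1).
  move=> cr z; apply: (@continuous_comp _ _ _ (r \o fst) fst); last exact: cvg_fst.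
  by apply: continuous_comp; [exact: cvg_fst|exact: cr].
have c2 (r : I -> I * I) : continuous r -> continuous (fun z : I * I => (r z.1).2).
  move=> cr z; apply: (@continuous_comp _ _ _ (r \o fst) snd); last exact: cvg_snd.
  by apply: continuous_comp; [exact: cvg_fst|exact: cr].
pose conv (u a b : I) : I :=
  clamp ((1 - set_val u) * set_val a + set_val u * set_val b).
have conv0 a b : conv zero a b = a.
  by rewrite /conv val_zero subr0 mul1r mul0r addr0 clampK.
have conv1 a b : conv one a b = b.
  by rewrite /conv val_one subrr mul1r mul0r add0r clampK.
have convxx u a : conv u a a = a.
  by rewrite /conv -mulrDl subrK mul1r clampK.
exists (fun z => H (conv z.2 (s z.1).1 (t z.1).1, conv z.2 (s z.1).2 (t z.1).2)).
split => /=.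
- move=> z; apply: continuous_comp; last exact: cH.
  move: z; apply: pair_continuous; apply: continuous_convex;
    do ?[exact: c1|exact: c2]; by move=> z; exact: cvg_snd.
- by move=> r; rewrite !conv0 -surjective_pairing pE.
- by move=> r; rewrite !conv1 -surjective_pairing qE.
- move=> u; rewrite e0 e1 !convxx -!surjective_pairing.
  by rewrite -[H (t zero)]qE -[H (t one)]qE path_zero path_one.
Qed.

(* A null-homotopy of the loop [d . p . d^-1] at [x] restricts to [p] over the
   interval [1/4, 1/2] of the bottom edge of the square; going around the square
   the other way reads [d^-1 . d]. *)
Lemma null_homotopic_base_point (x y : X) (d : I -> X) (p : loop R y) :
  continuous d -> d zero = x -> d one = y ->
  (forall l : loop R x, homotopic l (loop_cst x)) -> homotopic p (loop_cst y).
Proof.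
move=> cd d0 d1 null.
pose dp : I -> X := path_cat d p.
have cdp : continuous dp.
  by apply: path_cat_continuous => //; rewrite ?d1 ?path_zero//; exact: cts_fun.
pose L0 : I -> X := path_cat dp (path_rev d).
have cL : continuous L0.
  apply: path_cat_continuous => //; first exact: path_rev_continuous.
  by rewrite path_rev0 /dp path_cat1 path_one d1.
have L00 : L0 zero = x by rewrite /L0 path_cat0 /dp path_cat0.
have L01 : L0 one = x by rewrite /L0 path_cat1 path_rev1.
pose L : loop R x :=
  [the {path I from x to x in X} of mk_path cL L00 L01].
have [H [cH H0 H1 Hu]] := null L.
have {}H0 t : H (t, zero) = L0 t by rewrite H0.
have {}H1 t : H (t, one) = x by rewrite H1.
have cval : continuous (set_val : I -> R) by exact: itv_val_continuous.
have aff (a b : R) : continuous (fun t : I => a * set_val t + b).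
  move=> t; apply: (@continuousD R R I (fun t => a * set_val t) (cst b));
    last exact: cst_continuous.
  apply: (@continuousM R I (cst a) set_val); first exact: cst_continuous.
  exact: cval.
have cmax (g : I -> R) : continuous g -> continuous (fun t => Num.max 0 (g t)).
  move=> cg t; apply: (@continuous_max R I (cst 0) g); last exact: cg.
  exact: cst_continuous.
have cmin (h g : I -> R) : continuous h -> continuous g ->
    continuous (fun t => Num.min (h t) (g t)).
  by move=> ch cg t; apply: (@continuous_min R I h g); [exact: ch|exact: cg].
have cadd (h g : I -> R) : continuous h -> continuous g ->
    continuous (fun t => h t + g t).
  by move=> ch cg t; apply: (@continuousD R R I h g); [exact: ch|exact: cg].
have cclamp (g : I -> R) : continuous g -> continuous (fun t => clamp (g t) : I).
  by move=> cg t; apply: continuous_comp; [exact: cg|exact: clamp_continuous].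
(* [L0] reads [d] on [0, 1/4], [p] on [1/4, 1/2] and [d] reversed on [1/2, 1]; [s] runs along the
   piece of the bottom edge that carries [p]. *)
pose s (t : I) : I * I := (clamp (4^-1 * set_val t + 4^-1), zero).
(* The path [r] spends one fifth of the time on each stretch: along the bottom edge from 1/4 to 0,
   up the left edge, across the top, down the right edge, and along the bottom edge from 1 to
   1/2. *)
pose g1 (t : I) : R := Num.max 0 (- (5 / 4) * set_val t + 4^-1) +
  Num.max 0 (Num.min 1 (5 * set_val t + -2)) +
  - Num.max 0 (5 / 2 * set_val t + -2).
pose g2 (t : I) : R := Num.min (5 * set_val t + -1) (- 5 * set_val t + 4).
pose r (t : I) : I * I := (clamp (g1 t), clamp (g2 t)).
(* [k] is the parameter of [d] along [r]: it falls from 1 to 0 in the first fifth, stays at 0 on the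
   three edges that [H] sends to [x], and rises back to 1 in the last fifth. Hence
   [d \o k = H \o r]. *)
pose k (t : I) : I := clamp (Num.max 0 (-5 * set_val t + 1) +
                             Num.max 0 (5 * set_val t + -4)).
have ck : continuous k by apply: cclamp; apply: (cadd); apply: (cmax); exact: aff.
have cr : continuous r.
  apply: pair_continuous; apply: cclamp; last by rewrite /g2; apply: cmin; exact: aff.
  rewrite /g1; apply: (cadd); last first.
    move=> t; apply: (@continuousN R R I (fun t => Num.max 0 (5 / 2 * set_val t + -2))).
    by apply: (cmax); exact: aff.
  apply: (cadd); apply: (cmax); first exact: aff.
  by apply: (cmin (cst 1)); [exact: cst_continuous|exact: aff].
have cs : continuous s.
  by apply: pair_continuous; [apply: cclamp; exact: aff|exact: cst_continuous].
have k0 : k zero = one.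
  by rewrite /k val_zero; apply: clamp_one; rewrite max_r ?max_l; lra.
have k1 : k one = one.
  by rewrite /k val_one; apply: clamp_one; rewrite max_l ?max_r; lra.
have dk0 : (d \o k) zero = y by rewrite /= k0.
have dk1 : (d \o k) one = y by rewrite /= k1.
have cdk : continuous (d \o k).
  by move=> t; apply: continuous_comp; [exact: ck|exact: cd].
pose m : loop R y := [the {path I from y to y in X} of mk_path cdk dk0 dk1].
(* The loop [m] is [d \o k] with [k] starting and ending at [one], so it contracts through the
   interval to the constant loop. *)
apply: (@homotopic_trans _ _ _ m); last first.
  apply: (@homotopic_reparam _ _ _ d k (cst one)) => //.
  exact: cst_continuous.
apply: (@homotopic_in_square _ H s r) => //.
- rewrite /s /r /g1 /g2 val_zero; congr (_, _).
    by congr clamp; rewrite max_r ?(@min_r _ _ 1) ?max_l; lra.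
  by rewrite [RHS]clamp_zero// ge_min; apply/orP; left; lra.
- rewrite /s /r /g1 /g2 val_one; congr (_, _).
    by congr clamp; rewrite max_l ?(@min_l _ _ 1) ?max_r; lra.
  by rewrite [RHS]clamp_zero// ge_min; apply/orP; right; lra.
- move=> t; have /andP[t0 t1] := unit_interval_bound t.
  rewrite /= /s H0 /L0 /path_cat set_val_clamp; [|lra..].
  rewrite ifT; last lra.
  rewrite /dp /path_cat set_val_clamp; [|lra..].
  have [t2|t2] := leP (2 * (4^-1 * set_val t + 4^-1)) (2^-1 : R).
    have -> : t = zero.
      by rewrite -[t]clampK; apply: clamp_zero; lra.
    by rewrite path_zero val_zero clamp_one ?d1//; lra.
  by rewrite -[in LHS](clampK t); congr (p (clamp _)); lra.
- move=> t; have /andP[t0 t1] := unit_interval_bound t.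
  change (d (k t) = H (r t)); rewrite /k /r /g1 /g2.
  set a := set_val t in t0 t1 *.
  have [t15|t15] := leP a (5^-1).
    rewrite [X in H (_, X)]clamp_zero; last first.
      by rewrite ge_min; apply/orP; left; lra.
    rewrite H0 (@max_r _ _ 0 (-5 * _ + 1)) ?(@max_l _ _ 0 (5 * _ + -4)); [|lra..].
    rewrite (@max_r _ _ 0 (- (5/4) * _ + _)) ?(@max_l _ _ 0 (5 / 2 * _ + _)); [|lra..].
    rewrite (@min_r _ _ 1) ?(@max_l _ _ 0 (5 * _ + _)); [|lra..].
    rewrite /L0 /path_cat set_val_clamp; [|lra..].
    rewrite ifT; last lra.
    rewrite /dp /path_cat set_val_clamp; [|lra..].
    rewrite ifT; last lra.
    by congr (d (clamp _)); lra.
  have [t45|t45] := leP (4 / 5) a.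
    rewrite [X in H (_, X)]clamp_zero; last first.
      by rewrite ge_min; apply/orP; right; lra.
    rewrite H0 (@max_l _ _ 0 (-5 * _ + 1)) ?(@max_r _ _ 0 (5 * _ + -4)); [|lra..].
    rewrite (@max_l _ _ 0 (- (5/4) * _ + _)) ?(@max_r _ _ 0 (5 / 2 * _ + _)); [|lra..].
    rewrite (@min_l _ _ 1) ?(@max_r _ _ 0 1); [|lra..].
    rewrite /L0 /path_cat set_val_clamp; [|lra..].
    have [t2|t2] := leP _ (2^-1 : R).
      rewrite clamp_one; last by lra.
      by rewrite clamp_one ?d1 /dp ?path_cat1 ?path_one//; lra.
    rewrite /path_rev set_val_clamp; [|lra..].
    by congr (d (clamp _)); lra.
  rewrite [X in d X]clamp_zero ?d0; last by rewrite !max_l; lra.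
  have [t25|t25] := leP a (2 / 5).
    rewrite [X in H (X, _)]clamp_zero ?(Hu _).1//.
    by rewrite (@max_l _ _ 0 (- (5/4) * _ + _)) ?(@max_l _ _ 0 (5 / 2 * _ + _))
      ?(@min_r _ _ 1) ?(@max_l _ _ 0 (5 * _ + _)); lra.
  have [t35|t35] := leP a (3 / 5).
    rewrite [X in H (_, X)]clamp_one ?H1//.
    by rewrite le_min; apply/andP; split; lra.
  rewrite [X in H (X, _)]clamp_one ?(Hu _).2//.
  by rewrite (@max_l _ _ 0 (- (5/4) * _ + _)) ?(@max_l _ _ 0 (5 / 2 * _ + _))
    ?(@min_l _ _ 1) ?(@max_r _ _ 0 1); lra.
Qed.

Lemma pi1_trivialP (x : X) :
  (forall a : pi1 R X x, a = 1%g) <->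
  forall l : loop R x, homotopic l (loop_cst x).
Proof.
split=> [triv l|null]; last by elim/quotW => l; exact/eqP/pi1_eqP.
by apply/pi1_eqP/eqP; exact: triv.
Qed.

End base_point_change.

(** * Pullback of a simply connected covering *)

Section monodromy.
Context {R : realType} {E X : topologicalType} (q : E -> X).
Hypothesis cov_q : is_covering q.
Local Notation I := (unit_interval R).

Lemma constant_lift (k : I -> E) : continuous k ->
  (forall t, q (k t) = q (k zero)) -> forall t, k t = k zero.
Proof.
move=> ck qk; apply: (unique_path_lift cov_q (l := cst (k zero))) => //.
exact: cst_continuous.
Qed.

Lemma continuous_slice1 (Z : topologicalType) (H : I * I -> Z) (u : I) :
  continuous H -> continuous (fun t => H (t, u)).
Proof.
move=> cH t; apply: (@continuous_comp _ _ _ (fun t => (t, u)) H); last exact: cH.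
by move: t; apply: pair_continuous => t; [exact: cvg_id|exact: cst_continuous].
Qed.

Lemma continuous_slice2 (Z : topologicalType) (H : I * I -> Z) (t : I) :
  continuous H -> continuous (fun u => H (t, u)).
Proof.
move=> cH u; apply: (@continuous_comp _ _ _ (fun u => (t, u)) H); last exact: cH.
by move: u; apply: pair_continuous => u; [exact: cst_continuous|exact: cvg_id].
Qed.

(** The lift of the square restricts to [l] on the bottom edge by uniqueness of path lifts; its
    vertical edges lie over single points and are constant by [constant_lift]. *)
Lemma homotopy_lift (H : I * I -> X) (l : I -> E) : continuous H ->
  (forall u, H (zero, u) = H (zero, zero) /\ H (one, u) = H (one, zero)) ->
  continuous l -> (forall t, q (l t) = H (t, zero)) ->
  exists K : I * I -> E, [/\ continuous K, forall z, q (K z) = H z,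
    forall t, K (t, zero) = l t &
    forall u, K (zero, u) = l zero /\ K (one, u) = l one].
Proof.
move=> cH Hu cl ql; have [K [cK qK K0]] := square_lift cov_q cH (ql zero).
have Kl : (fun t => K (t, zero)) =1 l.
  apply: (unique_path_lift cov_q) => //; first exact: continuous_slice1.
  by move=> t; rewrite qK ql.
exists K; split => // u; rewrite -!Kl.
split; [pose k u := K (zero, u)|pose k u := K (one, u)];
  apply: (@constant_lift k); try exact: continuous_slice2;
  by move=> v; rewrite /k !qK; have [? ?] := Hu v.
Qed.

End monodromy.

(** * Joining points by paths *)

Section path_components.
Context {R : realType} {X : topologicalType}.
Local Notation I := (unit_interval R).

Definition joined (x y : X) : Prop :=
  exists p : I -> X, [/\ continuous p, p zero = x & p one = y].

Lemma joinedP (x y : X) :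
  joined x y <-> inhabited {path I from x to y in X}.
Proof.
split=> [[p [cp p0 p1]]|[p]].
  by constructor; exact: [the {path I from x to y in X} of mk_path cp p0 p1].
by exists p; split; [exact: cts_fun|exact: path_zero|exact: path_one].
Qed.

Lemma joined_refl x : joined x x.
Proof. by exists (cst x); split => //; exact: cst_continuous. Qed.

Lemma joined_sym x y : joined x y -> joined y x.
Proof.
move=> [p [cp p0 p1]]; exists (path_rev p).
by rewrite path_rev0 path_rev1; split => //; exact: path_rev_continuous.
Qed.

Lemma joined_trans y x z : joined x y -> joined y z -> joined x z.
Proof.
move=> [p [cp p0 p1]] [q [cq q0 q1]]; exists (path_cat p q).
rewrite path_cat0 path_cat1; split => //.
by apply: path_cat_continuous; rewrite ?p1 ?q0.
Qed.

End path_components.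
Arguments joined R {X}.

(** * The pullback of a covering is a covering *)

Section pullback.
Context {Y E X : topologicalType} (f : Y -> X) (q : E -> X).

Definition pullback_set : set (Y * E) := [set z | f z.1 = q z.2].

(* The base point is a parameter so that the pullback is a pointed type. *)
Definition pullback (p0 : set_type pullback_set) := set_type pullback_set.

Variable p0 : set_type pullback_set.
Local Notation P := (pullback p0).

HB.instance Definition _ := Topological.copy P (set_type pullback_set).
HB.instance Definition _ := isPointed.Build P p0.

Definition pb_base (z : P) : Y := (set_val z).1.
Definition pb_total (z : P) : E := (set_val z).2.

Lemma pbE (z : P) : f (pb_base z) = q (pb_total z).
Proof. exact: set_valP z. Qed.

Lemma pb_val_continuous : continuous (set_val : P -> Y * E).
Proof. exact: initial_continuous. Qed.

Lemma pb_base_continuous : continuous pb_base.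
Proof.
move=> z; apply: (@continuous_comp _ _ _ (set_val : P -> Y * E) fst).
  exact: pb_val_continuous.
exact: cvg_fst.
Qed.

Lemma pb_total_continuous : continuous pb_total.
Proof.
move=> z; apply: (@continuous_comp _ _ _ (set_val : P -> Y * E) snd).
  exact: pb_val_continuous.
exact: cvg_snd.
Qed.

Lemma pb_eq (z w : P) : pb_base z = pb_base w -> pb_total z = pb_total w -> z = w.
Proof.
rewrite /pb_base /pb_total => e1 e2; apply: val_inj.
change (set_val z = set_val w).
by rewrite (surjective_pairing (set_val z)) e1 e2 -surjective_pairing.
Qed.

(** A total pairing with default value [p0] outside the pullback: maps into the pullback are then
    given by their components, without membership proofs inside terms. *)
Definition pb_pair (y : Y) (e : E) : P :=
  match pselect (f y = q e) with
  | left h => SigSub (mem_set (h : pullback_set (y, e)))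
  | right _ => p0
  end.

Lemma pb_pair_base y e : f y = q e -> pb_base (pb_pair y e) = y.
Proof. by move=> h; rewrite /pb_pair; case: pselect. Qed.

Lemma pb_pair_total y e : f y = q e -> pb_total (pb_pair y e) = e.
Proof. by move=> h; rewrite /pb_pair; case: pselect. Qed.

Lemma pb_pairK (z : P) : pb_pair (pb_base z) (pb_total z) = z.
Proof. by apply: pb_eq; rewrite ?pb_pair_base ?pb_pair_total ?pbE. Qed.

Lemma pb_pair_val y e : f y = q e -> set_val (pb_pair y e) = (y, e).
Proof.
move=> h; rewrite (surjective_pairing (set_val _)).
by rewrite -/(pb_base _) -/(pb_total _) pb_pair_base// pb_pair_total.
Qed.

Lemma within_pb_pair (Z : topologicalType) (A : set Z) (a : Z -> Y) (b : Z -> E) :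
  (forall z, A z -> f (a z) = q (b z)) ->
  {within A, continuous a} -> {within A, continuous b} ->
  {within A, continuous (fun z => pb_pair (a z) (b z))}.
Proof.
move=> ab ca cb; apply: continuous_comp_initial.
apply: (@subspace_eq_continuous _ A _ (fun z => (a z, b z))).
  by move=> z /set_mem Az; rewrite /= pb_pair_val// ab.
by apply: (@pair_continuous (subspace A)).
Qed.

Lemma pb_pair_continuous (Z : topologicalType) (a : Z -> Y) (b : Z -> E) :
  (forall z, f (a z) = q (b z)) -> continuous a -> continuous b ->
  continuous (fun z => pb_pair (a z) (b z)).
Proof.
move=> ab ca cb; apply/continuous_subspace_setT.
by apply: within_pb_pair => //; exact: continuous_subspaceT.
Qed.

Definition pb_sheet (V : set E) : set P := [set z | V (pb_total z)].

(** A sheet [V] of [q] over [U] induces the sheet of points whose [E]-component lies in [V]; its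
    section is [y |-> (y, s (f y))]. *)
Lemma evenly_covered_pb (U : set X) : continuous f ->
  evenly_covered q U -> evenly_covered pb_base (f @^-1` U).
Proof.
move=> cf [F [oF tF FE Fs]]; exists (pb_sheet @` F); split.
- move=> _ [V FV <-]; apply: open_comp (oF _ FV) => z _.
  exact: pb_total_continuous.
- move=> _ _ [V FV <-] [W FW <-] [z [Vz Wz]].
  by congr pb_sheet; apply: (tF _ _ FV FW); exists (pb_total z).
- apply/seteqP; split=> z /=.
    rewrite pbE => Uz; have [V FV Vz] : (\bigcup_(V in F) V) (pb_total z).
      by rewrite -FE.
    by exists (pb_sheet V) => //; exists V.
  move=> [_ [V FV <-] Vz]; rewrite pbE -[U _]/((q @^-1` U) _) FE.
  by exists V.
- move=> _ [V FV <-]; have [s [cs sU sV]] := Fs _ FV.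
  exists (fun y => pb_pair y (s (f y))); split.
  + apply: within_pb_pair.
    * by move=> y Uy; have [_ ->] := sU _ Uy.
    * by apply: continuous_subspaceT => y; exact: cvg_id.
    * apply: (continuous_subspace_comp _ _ cs); first exact: continuous_subspaceT.
      exact: image_preimage_subset.
  + move=> y Uy; have [Vs qs] := sU _ Uy.
    by rewrite /pb_sheet /= pb_pair_total ?pb_pair_base ?qs.
  + by move=> z Vz; rewrite pbE sV// pb_pairK.
Qed.

Lemma is_covering_pb : continuous f -> is_covering q -> is_covering pb_base.
Proof.
move=> cf [cq evq]; split; first exact: pb_base_continuous.
move=> y; have [U [oU Ufy eU]] := evq (f y); exists (f @^-1` U); split => //.
- by apply: open_comp oU => z _; exact: cf.
- exact: evenly_covered_pb.
Qed.

End pullback.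
Arguments pb_base {Y E X f q p0}.
Arguments pb_total {Y E X f q p0}.

(** * Simple connectedness of the pullback *)

Section pullback_simply_connected.
Context {R : realType} {Y E X : topologicalType}.
Variables (f : continuousType Y X) (q : E -> X) (p0 : set_type (pullback_set f q)).
Hypothesis cov_q : is_covering q.
Local Notation I := (unit_interval R).
Local Notation P := (pullback p0).
Let y0 : Y := pb_base (p0 : P).
Let e0 : E := pb_total (p0 : P).
Hypothesis iso_f : bijective (@pi1_map R Y X f y0).

(** A path to [y0] in [Y] lifts and moves [z] into the fibre over [y0]. Two points of that fibre are
    joined in [E] by a path over a loop at [f y0]; surjectivity on fundamental groups replaces this
    loop by the image of a loop in [Y]. *)
Lemma path_connected_pb : path_connected R Y -> path_connected R E ->
  path_connected R P.
Proof.
move=> pcY pcE.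
suff j0 (z : P) : joined R z (p0 : P).
  move=> z w; apply/joinedP; apply: (@joined_trans _ _ (p0 : P)) => //.
  exact/joined_sym.
have /joinedP[d [cd d0 d1]] := pcY (pb_base z) y0.
have cfd : continuous (f \o d).
  by move=> t; apply: continuous_comp; [exact: cd|exact: cts_fun].
have [|l [cl ql l0]] := path_lift cov_q cfd (e := pb_total z).
  by rewrite /= d0 pbE.
apply: (@joined_trans _ _ (pb_pair p0 y0 (l one))).
  exists (fun t => pb_pair p0 (d t) (l t)); split.
  - by apply: pb_pair_continuous => // t; rewrite ql.
  - by rewrite d0 l0 pb_pairK.
  - by rewrite d1.
have /joinedP[g [cg g0 g1]] := pcE (l one) e0.
have [cq _] := cov_q.
have cqg : continuous (q \o g).
  by move=> t; apply: continuous_comp; [exact: cg|exact: cq].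
have qg0 : (q \o g) zero = f y0 by rewrite /= g0 ql /= d1.
have qg1 : (q \o g) one = f y0 by rewrite /= g1 /e0 -pbE.
pose qg : loop R (f y0) :=
  [the {path I from (f y0) to (f y0) in X} of mk_path cqg qg0 qg1].
have [m hm] : exists m : loop R y0, homotopic qg (loop_map f m).
  have [h _ fh] := iso_f; have := fh (\pi_(pi1 R X (f y0)) qg).
  elim/quotW: (h _) => m; rewrite pi1_mapE => /esym/eqP/pi1_eqP mE.
  by exists m.
have [H [cH H0 H1 Hu]] := hm.
(* Lifting the homotopy from [g] leaves the endpoints in place; its last stage lies over [f \o m]
   and so pairs with [m]. *)
have [|//||K [cK qK K0 Ku]] := homotopy_lift cov_q (l := g) cH.
- by move=> u; rewrite !(Hu _).1 !(Hu _).2.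
- by move=> t; rewrite H0.
exists (fun t => pb_pair p0 (m t) (K (t, one))); split.
- apply: pb_pair_continuous; [|exact: cts_fun|exact: continuous_slice1].
  by move=> t; rewrite qK H1.
- by rewrite path_zero (Ku one).1 g0.
- by rewrite path_one (Ku one).2 g1 /e0 pb_pairK.
Qed.

Lemma simply_connected_pb : path_connected R Y -> simply_connected R E ->
  simply_connected R P.
Proof.
move=> pcY [_ pcE trivE]; split; first by exists p0.
  exact: path_connected_pb.
move=> z; apply/pi1_trivialP => l.
have /joinedP[d [cd d0 d1]] := path_connected_pb pcY pcE p0 z.
(* The hypothesis on [f] concerns [y0] only, so the loop is moved to the base point [p0] above
   it. *)
apply: (@null_homotopic_base_point R P (p0 : P) z d l) => // {l d cd d0 d1 z} g.
have ca : continuous (pb_base \o g).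
  by move=> t; apply: continuous_comp; [exact: cts_fun|exact: pb_base_continuous].
have cb : continuous (pb_total \o g).
  by move=> t; apply: continuous_comp; [exact: cts_fun|exact: pb_total_continuous].
have a0 : (pb_base \o g) zero = y0 by rewrite /= path_zero.
have a1 : (pb_base \o g) one = y0 by rewrite /= path_one.
have b0 : (pb_total \o g) zero = e0 by rewrite /= path_zero.
have b1 : (pb_total \o g) one = e0 by rewrite /= path_one.
pose a : loop R y0 := [the {path I from y0 to y0 in Y} of mk_path ca a0 a1].
pose b : loop R e0 := [the {path I from e0 to e0 in E} of mk_path cb b0 b1].
(* The loop [f \o a] equals [q \o b], and [b] contracts in [E]. *)
have fa : homotopic (loop_map f a) (loop_map f (loop_cst y0)).
  have /pi1_trivialP/(_ b)[G [cG G0 G1 Gu]] := trivE e0.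
  have qe0 : q e0 = f y0 by exact: esym (pbE (p0 : P)).
  exists (q \o G); split => /=.
  - by move=> t; apply: continuous_comp; [exact: cG|exact: cov_q.1].
  - by move=> t; rewrite G0 -[RHS]/(f (pb_base (g t))) pbE.
  - by move=> t; rewrite G1.
  - by move=> u; rewrite (Gu u).1 (Gu u).2.
have /pi1_eqP[H [cH H0 H1 Hu]] : \pi_(pi1 R Y y0) a == \pi_(pi1 R Y y0) (loop_cst y0).
  by apply/eqP/(bij_inj iso_f); rewrite !pi1_mapE; exact/eqP/pi1_eqP.
have cfH : continuous (f \o H).
  by move=> t; apply: continuous_comp; [exact: cH|exact: cts_fun].
have [|//||K [cK qK K0 Ku]] := homotopy_lift cov_q (l := pb_total \o g) cfH.
- by move=> u; rewrite /= !(Hu _).1 !(Hu _).2.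
- by move=> t; rewrite /= H0 -[a t]/(pb_base (g t)) pbE.
exists (fun z => pb_pair p0 (H z) (K z)); split.
- by apply: pb_pair_continuous => // z; rewrite qK.
- by move=> t; rewrite H0 K0 pb_pairK.
- move=> t; rewrite H1.
  (* The last stage of the lift lies over a constant loop, hence is constant. *)
  have -> : K (t, one) = e0.
    rewrite -b0 -(Ku one).1; apply: (@constant_lift R _ _ q cov_q (fun t => K (t, one))).
      exact: continuous_slice1.
    by move=> s; rewrite !qK /= !H1.
  by rewrite /= pb_pairK.
- by move=> u; rewrite (Hu u).1 (Hu u).2 (Ku u).1 (Ku u).2 b0 b1 !pb_pairK.
Qed.

End pullback_simply_connected.

(** * Extension of functions on CW complexes *)

Section disks.
Context {R : realType}.

Lemma sum_sqr_continuous k : continuous (fun v : 'rV[R]_k => \sum_i v 0 i ^+ 2).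
Proof.
elim: (index_enum _) => [|i r ih] v.
  by under eq_fun do rewrite big_nil; exact: cst_continuous.
under eq_fun do rewrite big_cons.
apply: (@continuousD R R 'rV[R]_k (fun v => v 0 i ^+ 2)); last exact: ih.
by apply: (@continuousM R 'rV[R]_k (fun v => v 0 i) (fun v => v 0 i));
  exact: coord_continuous.
Qed.

Lemma disk_closed k : closed (@disk R k).
Proof.
have -> : @disk R k = (fun v => \sum_i v 0 i ^+ 2) @^-1` [set x | x <= 1] by [].
by apply: preimage_closed => [v _|]; [exact: sum_sqr_continuous|exact: closed_le].
Qed.

Lemma sphere_closed k : closed (@sphere R k).
Proof.
have -> : @sphere R k = (fun v => \sum_i v 0 i ^+ 2) @^-1` [set x | x = 1] by [].
by apply: preimage_closed => [v _|]; [exact: sum_sqr_continuous|exact: closed_eq].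
Qed.

Lemma disk_compact k : compact (@disk R k).
Proof.
have cpt := @rV_compact R k (fun=> `[-1, 1]%classic)
  (fun=> @segment_compact R (-1) 1).
apply: (subclosed_compact (@disk_closed k) cpt) => v dv i.
have : v 0 i ^+ 2 <= 1.
  apply: le_trans dv; rewrite (bigD1 i)//= lerDl.
  by apply: sumr_ge0 => j _; exact: sqr_ge0.
by rewrite /= in_itv/= expr2 => vi; apply/andP; split; nra.
Qed.

Lemma sphere_sub_disk k : @sphere R k `<=` @disk R k.
Proof. by move=> v sv; rewrite /disk /= sv. Qed.

Lemma open_disk_sub_disk k : @open_disk R k `<=` @disk R k.
Proof. by move=> v /ltW. Qed.

Lemma disk_split k (v : 'rV[R]_k) : disk v -> open_disk v \/ sphere v.
Proof. by rewrite /disk /= le_eqVlt => /orP[/eqP|]; [right|left]. Qed.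

Lemma disk_scale k (v : 'rV[R]_k) (t : R) : 0 <= t -> t <= 1 -> disk v ->
  disk (t *: v).
Proof.
move=> t0 t1; apply: le_trans; apply: ler_sum => i _; rewrite mxE exprMn.
by rewrite ler_piMl ?sqr_ge0// expr_le1.
Qed.

End disks.

(** * Cells and path connectedness *)

Section cells.
Context {R : realType} {X : topologicalType} (cwX : @cw_structure R X).
Local Notation cell := (cw_cell cwX).
Local Notation I := (unit_interval R).

Lemma in_open_cell x : exists c : cell, open_cell c x.
Proof.
have : [set: X] x by [].
by rewrite -(cw_cover cwX) => -[c _ cx]; exists c.
Qed.

Lemma open_cell_inj (c d : cell) x : open_cell c x -> open_cell d x -> c = d.
Proof. by move=> cx dx; apply: cw_disjoint => //; exists x. Qed.

Lemma cw_char_inj (c : cell) (v w : 'rV[R]_(cw_dim c)) :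
  open_disk v -> open_disk w -> cw_char v = cw_char w -> v = w.
Proof.
have [g [_ gK]] := cw_char_homeo c.
by move=> dv dw vw; rewrite -(gK v dv) vw gK.
Qed.

Lemma sphere_cell (c : cell) (v : 'rV[R]_(cw_dim c)) : sphere v ->
  exists2 b : cell, (cw_dim b < cw_dim c)%N & open_cell b (cw_char v).
Proof.
move=> sv; have [S [_ Sdim cS]] := cw_closure_finite c.
have [b Sb bv] : (\bigcup_(b in S) open_cell b) (cw_char v).
  by apply: cS; exists v.
by exists b => //; exact: Sdim.
Qed.

Lemma disk_cell (c : cell) (v : 'rV[R]_(cw_dim c)) : disk v ->
  exists2 b : cell, (cw_dim b <= cw_dim c)%N & open_cell b (cw_char v).
Proof.
move=> /disk_split[dv|/sphere_cell[b bc bv]]; last by exists b => //; exact: ltnW.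
by exists c => //; exists v.
Qed.

Lemma cell_joined (c : cell) (v : 'rV[R]_(cw_dim c)) : disk v ->
  joined R (cw_char (0 : 'rV[R]_(cw_dim c))) (cw_char v).
Proof.
move=> dv; exists (fun t : I => cw_char (set_val t *: v)); split.
- apply/continuous_subspace_setT.
  apply: (continuous_subspace_comp _ _ (cw_char_continuous (c := c))).
    apply: continuous_subspaceT => t.
    by apply: continuousZr_tmp; exact: itv_val_continuous.
  move=> _ [t _ <-]; have /andP[t0 t1] := unit_interval_bound t.
  exact: disk_scale.
- by rewrite val_zero scale0r.
- by rewrite val_one scale1r.
Qed.

(** Each closed cell lies in one path component, by radial paths. So a union of path components
    meets every closed cell in all or nothing and is closed in the weak topology; a path component
    is therefore clopen. *)
Lemma cw_path_connected : connected [set: X] -> path_connected R X.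
Proof.
move=> connX x y; apply/joinedP.
have closed_union (P : set X) : (forall u v, joined R u v -> P u -> P v) ->
    closed P.
  move=> Pj; apply/(cw_weak_topology cwX) => c.
  have [P0|nP0] := pselect (P (cw_char (0 : 'rV[R]_(cw_dim c)))).
    rewrite (_ : _ `&` _ = @disk R (cw_dim c)); first exact: disk_closed.
    apply/seteqP; split => [v []//|v dv]; split => //=.
    by apply: Pj P0; exact: cell_joined.
  rewrite (_ : _ `&` _ = set0); first exact: closed0.
  rewrite -subset0 => v [dv Pv]; apply: nP0.
  by apply: Pj Pv; apply/joined_sym; exact: cell_joined.
suff -> : joined R x = [set: X] by [].
apply: connX.
- by exists x; exact: joined_refl.
- exists (joined R x); last by rewrite setTI.
  rewrite -closedC; apply: closed_union => u v uv nxu xv; apply: nxu.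
  by apply: joined_trans xv _; exact: joined_sym.
- exists (joined R x); last by rewrite setTI.
  by apply: closed_union => u v uv xu; apply: joined_trans xu uv.
Qed.

End cells.

(** * Tietze extension by induction over skeleta *)

Section extension.
Context {R : realType} {X : topologicalType} (cwX : @cw_structure R X).
Hypothesis hausX : hausdorff_space X.
Local Notation cell := (cw_cell cwX).
Variables (A : set X) (a : X -> R).
Hypotheses (clA : closed A) (ca : {within A, continuous a})
  (a1 : forall x, A x -> `|a x| <= 1).

(* Continuity on the (n-1)-skeleton is tested on characteristic maps. *)
Let good (n : nat) (g : X -> R) :=
  [/\ forall c : cell, (cw_dim c < n)%N ->
        {within @disk R (cw_dim c), continuous (g \o cw_char (c := c))},
      forall x, A x -> g x = a x & forall x, `|g x| <= 1].

Lemma closed_cell_preimage (g : X -> R) (c : cell) (W : set R) :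
  {within @disk R (cw_dim c), continuous (g \o cw_char (c := c))} -> closed W ->
  closed (@disk R (cw_dim c) `&` (g \o cw_char (c := c)) @^-1` W).
Proof.
move=> cg cW; rewrite closed_setSI; last exact: disk_closed.
by move/continuous_closedP : cg; exact.
Qed.

(* By closure-finiteness, the preimage of a closed set under [g] meets the boundary
   of a cell in the trace of a finite union of compact sets. *)
Lemma sphere_continuous n (g : X -> R) (c : cell) : good n g -> cw_dim c = n ->
  {within @sphere R (cw_dim c), continuous (g \o cw_char (c := c))}.
Proof.
move=> [cg _ _] cn; apply/continuous_closedP => W cW.
have [S [finS Sdim cS]] := cw_closure_finite c.
pose piece (b : cell) : set X :=
  cw_char (c := b) @` (@disk R (cw_dim b) `&` (g \o cw_char (c := b)) @^-1` W).
pose F := \bigcup_(b in S) piece b.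
have clF : closed F.
  apply: (@closed_bigcup X {classic cell} S piece finS) => b Sb.
  have cb := closed_cell_preimage (cg b _) cW.
  apply: compact_closed => //; apply: continuous_compact.
    by apply: continuous_subspaceW (cw_char_continuous (c := b)) => v [].
  apply: (subclosed_compact _ (@disk_compact R (cw_dim b))); last by move=> v [].
  by apply: cb; rewrite -cn; exact: Sdim.
apply/closed_subspaceP; exists (@disk R (cw_dim c) `&` cw_char (c := c) @^-1` F).
  exact: (cw_weak_topology cwX F).1 clF c.
apply/seteqP; split=> v [].
  move=> [dv [b Sb [w [dw Ww] vw]]] sv; split => //=.
  by rewrite /from_subspace /= -vw.
move=> Wv sv; split => //; split; first exact: sphere_sub_disk.
have [b Sb [w dw vw]] : (\bigcup_(b in S) open_cell b) (cw_char v).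
  by apply: cS; exists v.
exists b => //; exists w => //; split; first exact: open_disk_sub_disk.
by rewrite /= vw.
Qed.

(** Tietze's theorem in the metric space of row vectors. The values are prescribed on [D], the union
    of the boundary sphere and the preimage of [A]; both are closed, and [g] is continuous on
    each. *)
Lemma extend_over_cell n (g : X -> R) (c : cell) : good n g -> cw_dim c = n ->
  exists h : 'rV[R]_(cw_dim c) -> R,
    [/\ continuous h, forall v, `|h v| <= 1,
        forall v, sphere v -> h v = g (cw_char v) &
        forall v, disk v -> A (cw_char v) -> h v = g (cw_char v)].
Proof.
move=> gd cn; have [cg gA g1] := gd.
pose D := @sphere R (cw_dim c) `|` (@disk R (cw_dim c) `&` cw_char (c := c) @^-1` A).
have clDA : closed (@disk R (cw_dim c) `&` cw_char (c := c) @^-1` A).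
  exact: (cw_weak_topology cwX A).1 clA c.
have clD : closed D by apply: closedU => //; exact: sphere_closed.
have cgD : {within D, continuous (g \o cw_char (c := c))}.
  apply: withinU_continuous => //; first exact: sphere_closed.
    exact: sphere_continuous gd cn.
  apply: (@subspace_eq_continuous _ _ _ (a \o cw_char (c := c))).
    by move=> v /set_mem[_ Av]; rewrite /from_subspace /= gA.
  apply: continuous_subspace_comp ca.
    by apply: continuous_subspaceW (cw_char_continuous (c := c)) => v [].
  by move=> _ [v [_ Av] <-].
have [h [hg ch h1]] := continuous_bounded_extension pseudometric_normal clD
  ltr01 cgD (fun v _ => g1 (cw_char v)).
exists h; split => // v.
  by move=> sv; rewrite -hg// inE; left.
by move=> dv Av; rewrite -hg// inE; right.
Qed.

Lemma good_step n (g : X -> R) : good n g -> exists g' : X -> R,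
  good n.+1 g' /\
  forall c : cell, (cw_dim c < n)%N -> forall x, open_cell c x -> g' x = g x.
Proof.
move=> gd; have [cg gA g1] := gd.
(* Choose an extension over each [n]-cell. The new function uses it on the open [n]-cells and keeps
   [g] elsewhere; it is well defined because open cells are disjoint and characteristic maps are
   injective on open disks. *)
pose h (c : cell) (cn : cw_dim c = n) := projT1 (cid (extend_over_cell gd cn)).
have hP c (cn : cw_dim c = n) : [/\ continuous (h c cn),
    forall v, `|h c cn v| <= 1,
    forall v, sphere v -> h c cn v = g (cw_char v) &
    forall v, disk v -> A (cw_char v) -> h c cn v = g (cw_char v)].
  exact: projT2 (cid (extend_over_cell gd cn)).
have [g' g'P] : {g' : X -> R & forall x,
    (forall (c : cell) (cn : cw_dim c = n) v, open_disk v -> cw_char v = x ->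
      g' x = h c cn v) /\
    ((forall c : cell, cw_dim c = n -> ~ open_cell c x) -> g' x = g x)}.
  apply: (@choice _ _ (fun x r =>
    (forall (c : cell) (cn : cw_dim c = n) v, open_disk v -> cw_char v = x ->
      r = h c cn v) /\
    ((forall c : cell, cw_dim c = n -> ~ open_cell c x) -> r = g x))) => x.
  have [[c [cn cx]]|nx] := pselect (exists c : cell, cw_dim c = n /\ open_cell c x).
    have [v dv vx] := cx; exists (h c cn v); split; last by move=> /(_ c cn).
    move=> d dn w dw wx; have dx : open_cell d x by exists w.
    have e := open_cell_inj cx dx; subst d.
    by rewrite (cw_char_inj dv dw) ?vx ?wx// (Prop_irrelevance cn dn).
  exists (g x); split => // c cn v dv vx; exfalso; apply: nx; exists c.
  by split => //; exists v.
have g'low (c : cell) x : (cw_dim c < n)%N -> open_cell c x -> g' x = g x.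
  move=> cn cx; apply: (g'P x).2 => d dn dx.
  by move: cn; rewrite (open_cell_inj cx dx) dn ltnn.
exists g'; split => [|c cn x cx]; last exact: g'low cx.
have onA x : A x -> g' x = g x.
  move=> Ax; have [[c [cn cx]]|nx] := pselect (exists c : cell, cw_dim c = n /\ open_cell c x).
    have [v dv vx] := cx; have [_ _ _ hA] := hP c cn.
    rewrite ((g'P x).1 c cn v dv vx) hA ?vx//.
    exact: open_disk_sub_disk.
  by apply: (g'P x).2 => c cn cx; apply: nx; exists c.
split.
(* A closed cell of dimension below [n] meets only open cells of dimension below [n], where nothing
   has changed. *)
- move=> c; rewrite ltnS leq_eqVlt => /orP[/eqP cn|cn]; last first.
    apply: subspace_eq_continuous (cg c cn) => v /set_mem dv.
    have [b bc bv] := disk_cell dv.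
    by rewrite /from_subspace /= (g'low b)//; exact: leq_ltn_trans bc cn.
  have [ch _ hs _] := hP c cn.
  apply: subspace_eq_continuous (continuous_subspaceT ch) => v /set_mem dv.
  rewrite /from_subspace /=; have [odv|sv] := disk_split dv.
    by rewrite ((g'P _).1 c cn v odv).
  have [b bc bv] := sphere_cell sv.
  by rewrite hs// (g'low b)// -cn.
- by move=> x Ax; rewrite onA// gA.
- move=> x; have [[c [cn [v dv vx]]]|nx] := pselect (exists c : cell, cw_dim c = n /\ open_cell c x).
    by have [_ h1 _ _] := hP c cn; rewrite ((g'P x).1 c cn v dv vx).
  by rewrite (g'P x).2// => c cn cx; apply: nx; exists c.
Qed.

(** The successive extensions no longer change on a cell of dimension [d] from stage [d + 1] on, so
    they have a pointwise limit. Continuity is checked on closed cells by the weak topology, and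
    there the limit is a single stage. *)
Theorem cw_tietze : exists g : X -> R,
  [/\ continuous g, forall x, A x -> g x = a x & forall x, `|g x| <= 1].
Proof.
pose g0 x : R := if x \in A then a x else 0.
have gd0 : good 0 g0.
  split => // x; rewrite /g0; first by move=> /mem_set ->.
  by case: ifPn => [/set_mem/a1//|_]; rewrite normr0.
(* The step is made total by returning the input function when it is not [good], so that it can be
   iterated. *)
have [step stepP] : {step : nat * (X -> R) -> (X -> R) & forall ng,
    good ng.1 ng.2 -> good ng.1.+1 (step ng) /\
  forall c : cell, (cw_dim c < ng.1)%N -> forall x, open_cell c x ->
    step ng x = ng.2 x}.
  apply: (@choice _ _ (fun ng g' => good ng.1 ng.2 -> good ng.1.+1 g' /\
    forall c : cell, (cw_dim c < ng.1)%N -> forall x, open_cell c x ->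
    g' x = ng.2 x)) => -[n g].
  have [/good_step[g' g'P]|] := pselect (good n g); first by exists g'.
  by move=> ngd; exists g.
pose G := fix G n := if n is m.+1 then step (m, G m) else g0.
have gdG n : good n (G n).
  by elim: n => [|n ih] //=; have [] := stepP (n, G n) ih.
have stab (c : cell) x m : open_cell c x -> (cw_dim c < m)%N ->
    G m x = G (cw_dim c).+1 x.
  move=> cx; elim: m => // m ih; rewrite ltnS leq_eqVlt => /orP[/eqP -> //|cm].
  by have [_ /(_ c cm x cx) /= ->] := stepP (m, G m) (gdG m); exact: ih.
have [g gP] : {g : X -> R & forall x (c : cell), open_cell c x ->
    g x = G (cw_dim c).+1 x}.
  apply: (@choice _ _ (fun x r => forall c : cell, open_cell c x ->
    r = G (cw_dim c).+1 x)) => x.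
  have [c cx] := in_open_cell cwX x; exists (G (cw_dim c).+1 x) => d dx.
  by rewrite (open_cell_inj cx dx).
exists g; split.
- apply/continuous_closedP => W cW; apply/(cw_weak_topology cwX) => c.
  apply: (@closed_cell_preimage g c W) => //.
  have [cG _ _] := gdG (cw_dim c).+1.
  apply: subspace_eq_continuous (cG c (ltnSn _)) => v /set_mem dv.
  have [b bc bv] := disk_cell dv.
  change (G (cw_dim c).+1 (cw_char v) = g (cw_char v)).
  by rewrite (gP _ b bv) (stab b).
- move=> x Ax; have [c cx] := in_open_cell cwX x; rewrite (gP x c cx).
  by have [_ -> ] := gdG (cw_dim c).+1.
- by move=> x; have [c cx] := in_open_cell cwX x; rewrite (gP x c cx);
    have [_ _ ->] := gdG (cw_dim c).+1.
Qed.

End extension.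

(** Extend the function that is 1 at [x] and -1 off [U], then truncate. The value -1 instead of 0
    keeps the closed set where the extension is nonnegative inside [U]. *)
Lemma cw_bump (R : realType) (X : topologicalType) (U : set X) (x : X) :
  @is_cw_complex R X -> open U -> U x ->
  exists (g : X -> R) (C : set X), [/\ continuous g, forall y, 0 <= g y <= 1,
    \near x, g x = 1, closed C /\ C `<=` U & forall y, ~ C y -> g y = 0].
Proof.
move=> [hausX [cwX]] oU Ux.
have cx : closed [set x] by apply: compact_closed => //; exact: compact_set1.
have cU : closed (~` U) by exact: open_closedC.
pose a (y : X) : R := if y \in U then 1 else -1.
have [||f [cf fA f1]] := @cw_tietze R X cwX hausX ([set x] `|` ~` U) a (closedU cx cU).
- apply: withinU_continuous => //; first exact: continuous_subspace1.
  apply: (@subspace_eq_continuous _ _ _ (cst (-1 : R))).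
    by move=> y /set_mem nUy; rewrite /from_subspace /a memNset.
  by apply: continuous_subspaceT; exact: cst_continuous.
- by move=> y _; rewrite /a; case: ifP => _; rewrite ?normrN normr1.
have fx : f x = 1 by rewrite fA ?/a ?mem_set//; left.
(* The factor 2 makes the bump equal to 1 wherever [f] exceeds 1/2, hence on a whole neighbourhood
   of [x]. *)
exists (fun y => Num.max 0 (Num.min 1 (2 * f y))), (f @^-1` [set r | 0 <= r]); split.
- move=> y; apply: (@continuous_max R X (cst 0)); first exact: cst_continuous.
  apply: (@continuous_min R X (cst 1)); first exact: cst_continuous.
  by apply: (@continuousM R X (cst 2) f); [exact: cst_continuous|exact: cf].
- by move=> y; rewrite le_max lexx/= ge_max ler01 ge_min lexx.
- have : \near x, 2^-1 < f x.
    by apply: (cf x [set r | 2^-1 < r]); apply: lt_nbhsr; rewrite fx; lra.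
  by apply: filterS => y fy; rewrite min_l ?max_r//; lra.
- split; first by apply: preimage_closed => [y _|]; [exact: cf|exact: closed_ge].
  move=> y /= fy; apply: contrapT => nUy; have := fA y (or_intror nUy).
  by rewrite /a memNset// => fy1; move: fy; rewrite fy1; lra.
- move=> y /= /negP; rewrite -ltNge => fy.
  by rewrite min_r ?max_l//; lra.
Qed.

(** * Finitely supported measures *)

Section finite_measures.
Context {R : realType} {Z : ptopologicalType}.
Local Notation prob := (borel_probability R Z).

Definition formal_sum (n : nat) (z : 'I_n -> Z) (a : 'I_n -> R)
    (mu : prob) : Prop :=
  forall A : set (borel Z), mu A = (\sum_i (a i)%:E * \d_(z i : borel Z) A)%E.

(** [msum] sums a family indexed by all naturals, so indices from [n] on carry the zero measure. *)
Definition weighted_dirac n (z : 'I_n -> Z) (a : 'I_n -> R) (a0 : forall i, 0 <= a i)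
    (k : nat) : {measure set (borel Z) -> \bar R} :=
  match @insub nat (fun i => (i < n)%N) 'I_n k with
  | Some i => mscale (NngNum (a0 i)) (dirac (z i : borel Z))
  | None => mzero
  end.

Lemma weighted_diracE n (z : 'I_n -> Z) (a : 'I_n -> R) (a0 : forall i, 0 <= a i)
    (i : 'I_n) : weighted_dirac z a0 i = mscale (NngNum (a0 i)) (dirac (z i : borel Z)).
Proof. by rewrite /weighted_dirac valK. Qed.

Lemma formal_sum_exists n (z : 'I_n -> Z) (a : 'I_n -> R) :
  (forall i, 0 <= a i) -> \sum_i a i = 1 -> exists mu : prob, formal_sum z a mu.
Proof.
move=> a0 a1; pose m := msum (weighted_dirac z a0) n.
have mE A : m A = (\sum_i (a i)%:E * \d_(z i : borel Z) A)%E.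
  by rewrite /m /msum; apply: eq_bigr => i _; rewrite weighted_diracE.
have mT : m setT = 1%E.
  rewrite mE -[1%E]/((1 : R)%:E) -a1 -sumEFin; apply: eq_bigr => i _.
  by rewrite diracT mule1.
pose P := Measure_isProbability.Build _ _ _ m mT.
pose mu : prob := HB.pack m P.
by exists mu => A; exact: mE.
Qed.

Lemma continuous_measurable (phi : Z -> R) : continuous phi ->
  measurable_fun [set: borel Z] (phi : borel Z -> R).
Proof.
move=> cphi; apply: (measurability _ (RGenOpens.measurableE R)).
move=> _ [_ [a [b ->] <-]]; rewrite setTI.
apply: sub_sigma_algebra.
by move/continuousP : cphi; apply; exact: interval_open.
Qed.

Lemma ge0_integral_formal_sum n (z : 'I_n -> Z) (a : 'I_n -> R) (mu : prob)
    (phi : borel Z -> \bar R) : (forall i, 0 <= a i) -> formal_sum z a mu ->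
  measurable_fun [set: borel Z] phi -> (forall x, 0 <= phi x)%E ->
  (\int[mu]_x phi x = \sum_i (a i)%:E * phi (z i))%E.
Proof.
move=> a0 muE mphi phi0.
rewrite (eq_measure_integral (msum (weighted_dirac z a0) n)); last first.
  move=> A _ _; apply: etrans (muE A) _; apply: eq_bigr => i _.
  by rewrite weighted_diracE.
rewrite ge0_integral_measure_sum//; apply: eq_bigr => i _.
rewrite weighted_diracE ge0_integral_mscale//.
by rewrite integral_dirac// diracT mul1e.
Qed.

Lemma integral_formal_sum n (z : 'I_n -> Z) (a : 'I_n -> R) (mu : prob)
    (phi : Z -> R) : (forall i, 0 <= a i) -> formal_sum z a mu ->
  continuous phi -> (\int[mu]_x phi x = \sum_i a i * phi (z i)).
Proof.
move=> a0 muE /continuous_measurable mphi.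
have mphi' : measurable_fun [set: borel Z] (EFin \o phi).
  exact/measurable_EFinP.
rewrite /Rintegral integralE.
rewrite (ge0_integral_formal_sum a0 muE) //; last exact: measurable_funepos.
rewrite (ge0_integral_formal_sum a0 muE) //; last exact: measurable_funeneg.
under eq_bigr do rewrite funeposE -EFin_max -EFinM.
under [X in (_ - X)%E]eq_bigr do rewrite funenegE -EFinN -EFin_max -EFinM.
rewrite !sumEFin -EFinB /= -sumrB; apply: eq_bigr => i _.
by rewrite -mulrBr /Num.max; do 2 case: ifP; move=> *; congr (_ * _); lra.
Qed.

End finite_measures.

(** * Sections of fiberwise measures *)

Section fiberwise_sections.
Context {R : realType} {E : ptopologicalType} {X : topologicalType}.
Variables (n : nat) (q : E -> X).
Local Notation fm := (fiberwise_measures R n q).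

Lemma bounded_funP (T : Type) (phi : T -> R) :
  bounded_fun phi <-> exists M, forall x, `|phi x| <= M.
Proof.
split=> [[M [_ HM]]|[M HM]].
  by exists (M + 1) => x; apply: HM => //; rewrite ltrDl.
by exists M; split; [exact: num_real|move=> N MN x _; apply: le_trans (ltW MN)].
Qed.

Lemma integral_section_continuous (s : X -> fm) (psi : E -> R) :
  continuous s -> continuous psi -> bounded_fun psi ->
  continuous (fun x => \int[set_val (s x)]_e psi e).
Proof.
move=> cs cpsi bpsi x.
pose psi' : set_type (bounded_continuous (R := R) (Z := E)) :=
  SigSub (mem_set (conj cpsi bpsi)).
pose T := {ptws set_type (bounded_continuous (R := R) (Z := E)) -> R}.
pose ev (h : T) : R := h psi'.
have cev : continuous ev := @proj_continuous _ (fun=> R) psi'.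
have cv : continuous (set_val : fm -> borel_probability R E).
  exact: initial_continuous.
have ci : continuous (@integrate_test R E : borel_probability R E -> T).
  exact: initial_continuous.
apply: (@continuous_comp _ _ _ (@integrate_test R E \o set_val \o s) ev).
  apply: (@continuous_comp _ _ _ s (@integrate_test R E \o set_val)); first exact: cs.
  by apply: (@continuous_comp _ _ _ set_val (@integrate_test R E)); [exact: cv|exact: ci].
exact: cev.
Qed.

(** Universal property of the two nested initial topologies: the subspace one and weak convergence,
    the latter tested one function at a time. *)
Lemma continuous_into_fiberwise (Z : topologicalType) (s : Z -> fm) :
  (forall psi : E -> R, continuous psi -> bounded_fun psi ->
    continuous (fun x => \int[set_val (s x)]_e psi e)) -> continuous s.
Proof.
move=> cint; apply: continuous_comp_initial; apply: continuous_comp_initial => x.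
apply/cvg_sup => psi U [V] [[W oW <-] Wx VU].
have [cpsi bpsi] := set_valP psi.
have nW := cint _ cpsi bpsi x W (open_nbhs_nbhs (conj oW Wx)).
by apply: (@filterS _ (nbhs x) _ _ _ _ nW) => t Wt; exact: VU.
Qed.

Lemma formal_sum_supp m (z : 'I_m -> E) (a : 'I_m -> R) mu (i : 'I_m) :
  (forall j, 0 <= a j) -> formal_sum z a mu -> 0 < a i -> supp mu (z i).
Proof.
move=> a0 muE ai U oU Uz; rewrite muE (bigD1 i)//= diracE mem_set// mule1.
apply: lt_le_trans (leeDl _ _); first by rewrite lte_fin.
by apply: sume_ge0 => j _; rewrite mule_ge0// lee_fin.
Qed.

Lemma sum1_gt0 m (a : 'I_m -> R) : \sum_i a i = 1 -> (forall i, 0 <= a i) ->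
  exists i, 0 < a i.
Proof.
move=> a1 a0; apply: contrapT => na; have : \sum_i a i = 0.
  apply: big1 => i _; apply/eqP; rewrite eq_le a0 andbT leNgt.
  by apply/negP => ai; apply: na; exists i.
by rewrite a1 => /eqP; rewrite oner_eq0.
Qed.

(** [fiberwise_map] picks its value by choice; the value is determined because some point has
    positive weight and thus lies in the support. *)
Lemma fiberwise_mapE (mu : fm) (b : X) :
  supp (set_val mu) `<=` q @^-1` [set b] -> fiberwise_map mu = b.
Proof.
move=> sb; have [[z [a [a0 a1 muE]]] _] := set_valP mu.
have [i ai] := sum1_gt0 a1 a0; have zi := formal_sum_supp a0 muE ai.
have e : q (z i) = fiberwise_map mu := projT2 (cid (proj2 (set_valP mu))) _ zi.
by rewrite -e; exact: sb.
Qed.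

(** The support controls only points of positive weight. Points of weight zero are replaced by one
    of positive weight, so that all of them lie in the fibre. *)
Lemma fiberwise_sum (mu : fm) : exists (z : 'I_n -> E) (a : 'I_n -> R),
  [/\ forall i, 0 <= a i, \sum_i a i = 1, formal_sum z a (set_val mu) &
      forall i, q (z i) = fiberwise_map mu].
Proof.
have [[z [a [a0 a1 muE]]] _] := set_valP mu.
have [i0 ai0] := sum1_gt0 a1 a0.
have qz i : 0 < a i -> q (z i) = fiberwise_map mu.
  move=> ai; have zi := formal_sum_supp a0 muE ai.
  exact: projT2 (cid (proj2 (set_valP mu))) _ zi.
pose w i := if 0 < a i then z i else z i0.
exists w, a; split => // [A|i]; last by rewrite /w; case: ifPn => [ai|_]; exact: qz.
rewrite muE; apply: eq_bigr => i _; rewrite /w; case: ifPn => //.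
rewrite -leNgt => ai; have -> : a i = 0 by apply/eqP; rewrite eq_le ai a0.
by rewrite !mul0e.
Qed.

End fiberwise_sections.

(** * Test functions that are constant on sheets *)

Section sheet_functions.
Context {R : realType} {E X : topologicalType} (q : E -> X).
Variables (U : set X) (F : set (set E)) (g : X -> R) (C : set X).
Hypotheses (cq : continuous q) (oF : forall V, F V -> open V)
  (UE : q @^-1` U = \bigcup_(V in F) V) (cg : continuous g) (clC : closed C)
  (CU : C `<=` U) (gC : forall x, ~ C x -> g x = 0).

(** Over [U] the factor [c] is locally constant, and over the complement of [C] the product
    vanishes. Since [C] lies in [U], these two open sets cover [E]. *)
Lemma sheet_function_continuous (c : E -> R) :
  (forall V e e', F V -> V e -> V e' -> c e = c e') ->
  continuous (fun e => g (q e) * c e).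
Proof.
move=> cF e.
have cgq : continuous (g \o q).
  by move=> u; apply: continuous_comp; [exact: cq|exact: cg].
have [Uqe|nUqe] := pselect (U (q e)).
  have [V FV Ve] : (\bigcup_(V in F) V) e by rewrite -UE.
  have ck : {for e, continuous (fun u => g (q u) * c e)}.
    apply: (@continuousM R E (g \o q) (cst (c e))); first exact: cgq.
    exact: cst_continuous.
  apply: cvg_trans ck; apply: near_eq_cvg.
  have : nbhs e V by apply: open_nbhs_nbhs; split => //; exact: oF.
  by apply: filterS => u Vu; rewrite (cF V e u).
have nCe : nbhs e (q @^-1` (~` C)).
  apply: cq; apply: open_nbhs_nbhs; split; first exact: closed_openC.
  by move=> /CU.
rewrite /continuous_at gC; last by move=> /CU.
rewrite mul0r; have c0 : {for e, continuous (cst (0 : R))} by exact: cst_continuous.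
apply: cvg_trans c0; apply: near_eq_cvg.
by apply: filterS nCe => u nCu; rewrite gC// mul0r.
Qed.

End sheet_functions.

(** * The induced section over [Y] *)

Section pullback_section.
Context {R : realType} {Y X : topologicalType} {E : ptopologicalType}.
Variables (f : Y -> X) (q : E -> X) (p0 : set_type (pullback_set f q)) (n : nat).
Local Notation P := (pullback p0).
Hypotheses (hausY : hausdorff_space Y) (cwX : @is_cw_complex R X)
  (cf : continuous f) (cov_q : is_covering q).
Variable s : X -> fiberwise_measures R n q.
Hypotheses (cs : continuous s) (sK : forall x, fiberwise_map (s x) = x).

Lemma pullback_measure (y : Y) :
  exists nu : fiberwise_measures R n (pb_base : P -> Y), fiberwise_map nu = y /\
  exists (z : 'I_n -> E) (a : 'I_n -> R), [/\ forall i, 0 <= a i,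
    \sum_i a i = 1, formal_sum z a (set_val (s (f y))),
    forall i, q (z i) = f y &
    formal_sum (fun i => pb_pair p0 y (z i)) a (set_val nu)].
Proof.
have [z [a [a0 a1 sE qz]]] := fiberwise_sum (s (f y)).
rewrite sK in qz.
have [mu muE] := @formal_sum_exists R P n (fun i => pb_pair p0 y (z i)) a a0 a1.
(* The complement of the fibre over [y] is open, since points of [Y] are closed, and it has measure
   zero. *)
have smu : supp mu `<=` pb_base @^-1` [set y].
  move=> w sw; apply: contrapT => nwy.
  have clY : closed [set y] by apply: compact_closed => //; exact: compact_set1.
  have oW : open (pb_base @^-1` (~` [set y]) : set P).
    by apply: open_comp (closed_openC clY) => u _; exact: pb_base_continuous.
  have := sw _ oW nwy; rewrite muE big1 ?ltxx// => i _.
  by rewrite diracE memNset ?mule0//= pb_pair_base ?qz//; apply.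
have mfw : fiberwise_set n (pb_base : P -> Y) mu.
  split; last by exists y.
  by exists (fun i => pb_pair p0 y (z i)), a.
pose nu : fiberwise_measures R n (pb_base : P -> Y) := SigSub (mem_set mfw).
exists nu; split; first exact: fiberwise_mapE.
by exists z, a; split => // i; rewrite qz.
Qed.

Lemma has_section_pullback : has_section R n (pb_base : P -> Y).
Proof.
have [sg sgP] := choice pullback_measure.
exists sg; split; last by move=> y; exact: (sgP y).1.
apply: continuous_into_fiberwise => phi cphi /bounded_funP[M phiM] y0.
have [_ [zs [as_ [as0 as1 sEs qzs sgEs]]]] := sgP y0.
have [cq /(_ (f y0)) [U [oU Uy0 [F [oF tF UE Fs]]]]] := cov_q.
have [g [C [cg g01 g1 [clC CU] gC]]] := cw_bump cwX oU Uy0.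
have M0 : 0 <= M by apply: le_trans (phiM p0).
(* [tau] slides a point along its sheet to the fibre over [f y0]; outside the sheets its value is
   arbitrary. *)
have [tau tauP] : {tau : E -> E & forall e V, F V -> V e ->
    V (tau e) /\ q (tau e) = f y0}.
  apply: (@choice _ _ (fun e e' => forall V, F V -> V e -> V e' /\ q e' = f y0)) => e.
  have [[V [FV Ve]]|nV] := pselect (exists V, F V /\ V e); last first.
    by exists e => V FV Ve; exfalso; apply: nV; exists V.
  have [t [_ tU _]] := Fs V FV; exists (t (f y0)) => W FW We.
  by rewrite (sheet_eq tF FW FV We Ve); exact: tU.
have tau_sheet V e e' : F V -> V e -> V e' -> tau e = tau e'.
  move=> FV Ve Ve'; have [t [_ _ tV]] := Fs V FV.
  have [V1 q1] := tauP e V FV Ve; have [V2 q2] := tauP e' V FV Ve'.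
  by rewrite -(tV _ V1) -(tV _ V2) q1 q2.
(* Indicator of the sheets that contain a point [zs i] of the measure at [f y0]. *)
pose chi (e : E) : R := `[< exists i V, [/\ F V, V e & V (zs i)] >]%:R.
have chi_sheet V e e' : F V -> V e -> V e' -> chi e = chi e'.
  move=> FV Ve Ve'; rewrite /chi; congr ((nat_of_bool _)%:R).
  apply/asboolP/asboolP => -[i [W [FW We Wz]]]; exists i, V.
    by move: Wz; rewrite -(sheet_eq tF FV FW Ve We).
  by move: Wz; rewrite -(sheet_eq tF FV FW Ve' We).
have sheet_zs i : exists V, F V /\ V (zs i).
  have [V FV Vz] : (\bigcup_(V in F) V) (zs i) by rewrite -UE /= qzs.
  by exists V.
(* The integral of [h] is 1 at [y0]; where [g (f y)] is 1, its deficit from 1 is the mass that has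
   left these sheets. [theta] is [phi] frozen at its values over [y0]. *)
pose h e := g (q e) * chi e.
pose theta e := g (q e) * phi (pb_pair p0 y0 (tau e)).
have ch : continuous h.
  exact: (sheet_function_continuous cq oF UE cg clC CU gC chi_sheet).
have ctheta : continuous theta.
  apply: (sheet_function_continuous cq oF UE cg clC CU gC) => V e e' FV Ve Ve'.
  by rewrite (tau_sheet V e e').
have chi01 e : 0 <= chi e <= 1 by rewrite /chi; case: asboolP; rewrite ?lexx ?ler01.
have bh : bounded_fun h.
  apply/bounded_funP; exists 1 => e; rewrite normrM.
  have /andP[? ?] := g01 (q e); have /andP[? ?] := chi01 e.
  by rewrite !ger0_norm// mulr_ile1.
have btheta : bounded_fun theta.
  apply/bounded_funP; exists M => e; rewrite normrM.
  have /andP[? ?] := g01 (q e).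
  by rewrite ger0_norm// (le_trans _ (phiM (pb_pair p0 y0 (tau e))))// ler_piMl.
have cint psi : continuous psi -> bounded_fun psi ->
    continuous (fun y => \int[set_val (s (f y))]_e psi e).
  move=> cpsi bpsi y; apply: (@continuous_comp _ _ _ f
    (fun x => \int[set_val (s x)]_e psi e)); first exact: cf.
  exact: integral_section_continuous.
have gy0 : g (f y0) = 1 by exact: nbhs_singleton g1.
have inth0 : \int[set_val (s (f y0))]_e h e = 1.
  rewrite (integral_formal_sum as0 sEs ch) -[RHS]as1; apply: eq_bigr => i _.
  rewrite /h qzs gy0 mul1r /chi asboolT ?mulr1//.
  by have [V [FV Vz]] := sheet_zs i; exists i, V.
have tau_zs i : tau (zs i) = zs i.
  have [V [FV Vz]] := sheet_zs i; have [t [_ _ tV]] := Fs V FV.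
  have [V1 q1] := tauP _ V FV Vz.
  by rewrite -(tV _ V1) -[RHS](tV _ Vz) q1 qzs.
have inttheta0 : \int[set_val (s (f y0))]_e theta e = \int[set_val (sg y0)]_e phi e.
  rewrite (integral_formal_sum as0 sEs ctheta) (integral_formal_sum as0 sgEs cphi).
  by apply: eq_bigr => i _; rewrite /theta qzs gy0 mul1r tau_zs.
apply/cvgrPdist_lt => e e0.
have e30 : 0 < e / 3 by rewrite divr_gt0.
(* Dividing by [2 * M + 1] rather than [2 * M] allows [M] to be 0. *)
have d0 : 0 < e / 3 / (2 * M + 1) by rewrite divr_gt0//; lra.
(* The section of the sheet through [zs i] turns [phi] into a continuous function of [y] near
   [y0]. *)
have nsheet i : \forall y \near y0, forall V z, F V -> V (zs i) -> V z ->
    q z = f y -> `|phi (pb_pair p0 y z) - phi (pb_pair p0 y0 (zs i))| < e / 3.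
  have [V [FV Vz]] := sheet_zs i; have [t [ct tU tV]] := Fs V FV.
  have ofU : open (f @^-1` U) by apply: open_comp oU => u _; exact: cf.
  have : {within f @^-1` U, continuous (phi \o (fun y => pb_pair p0 y (t (f y))))}.
    apply: (@continuous_subspace_comp _ _ _ _ setT) => //; last exact: continuous_subspaceT.
    apply: within_pb_pair.
    - by move=> y Uy; rewrite (tU _ Uy).2.
    - by apply: continuous_subspaceT => y; exact: cvg_id.
    - apply: (continuous_subspace_comp _ _ ct); first exact: continuous_subspaceT.
      exact: image_preimage_subset.
  rewrite continuous_open_subspace// => /(_ y0 (mem_set Uy0))/cvgrPdist_lt/(_ _ e30).
  apply: filterS => y; rewrite /= -[in t (f y0)](qzs i) tV// distrC => ty W z FW Wz Wz' qz.
  have WV := sheet_eq tF FW FV Wz Vz; rewrite WV in Wz'.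
  by rewrite -(tV _ Wz') qz.
near=> y.
have [_ [z [a [a0 a1 sE qz sgE]]]] := sgP y.
have gy : g (f y) = 1 by near: y; exact: (cf g1).
have nh : `|1 - \int[set_val (s (f y))]_e h e| < e / 3 / (2 * M + 1).
  near: y; have := cint h ch bh y0.
  by rewrite /continuous_at inth0 => /cvgrPdist_lt/(_ _ d0).
have ntheta : `|\int[set_val (sg y0)]_e phi e -
    \int[set_val (s (f y))]_e theta e| < e / 3.
  near: y; have := cint theta ctheta btheta y0.
  by rewrite /continuous_at inttheta0 => /cvgrPdist_lt/(_ _ e30).
have nsh : forall i V z, F V -> V (zs i) -> V z ->
    q z = f y -> `|phi (pb_pair p0 y z) - phi (pb_pair p0 y0 (zs i))| < e / 3.
  by near: y; exact: filter_forall.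
have diff : `|\int[set_val (sg y)]_e phi e - \int[set_val (s (f y))]_e theta e| <=
    e / 3 + 2 * M * (1 - \int[set_val (s (f y))]_e h e).
  rewrite (integral_formal_sum a0 sE ctheta) (integral_formal_sum a0 sE ch).
  rewrite (integral_formal_sum a0 sgE cphi) -sumrB.
  apply: (le_trans (ler_norm_sum _ _ _)).
  (* The weights sum to 1, so the bound is distributed over the points. A point in a sheet of some
     [zs j] contributes at most [e / 3]; for any other point [chi] is 0 and [2 * M] bounds the
     difference of two values of [phi]. *)
  have -> : e / 3 + 2 * M * (1 - \sum_i a i * h (z i)) =
      \sum_i a i * (e / 3 + 2 * M * (1 - h (z i))).
    rewrite [RHS](eq_bigr (fun i => a i * (e / 3 + 2 * M) -
      2 * M * (a i * h (z i)))); last by move=> i _; ring.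
    by rewrite sumrB -mulr_suml -mulr_sumr a1; ring.
  apply: ler_sum => i _; rewrite -mulrBr normrM ger0_norm//.
  apply: ler_wpM2l => //; rewrite /theta /h qz gy !mul1r /chi.
  case: asboolP => [[j [V [FV Vz Vzs]]]|_].
    rewrite subrr mulr0 addr0 (tau_sheet V _ (zs j))// tau_zs.
    by apply/ltW/(nsh j V).
  rewrite subr0 mulr1 (le_trans (ler_normB _ _))//.
  have := phiM (pb_pair p0 y (z i)).
  by have := phiM (pb_pair p0 y0 (tau (z i))); lra.
set A := \int[set_val (sg y0)]_e phi e in ntheta *.
set B := \int[set_val (sg y)]_e phi e in diff *.
set T := \int[set_val (s (f y))]_e theta e in ntheta diff *.
set H := \int[set_val (s (f y))]_e h e in nh diff *.
have nh2 : 2 * M * (1 - H) < e / 3.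
  have H1 : 1 - H < e / 3 / (2 * M + 1) by apply: le_lt_trans nh; exact: ler_norm.
  have [H0|H0] := leP (1 - H) 0; first by nra.
  move: H1; rewrite ltr_pdivlMr; last lra.
  by nra.
rewrite (_ : A - B = (A - T) - (B - T)); last by ring.
apply: (le_lt_trans (ler_normB _ _)); lra.
Unshelve. all: by end_near. Qed.

End pullback_section.

Theorem corollary3p9 (R : realType) (X Y : topologicalType)
    (cwX : @is_cw_complex R X) (cwY : @is_cw_complex R Y)
    (connX : connected [set: X]) (connY : connected [set: Y])
    (f : continuousType Y X) (y0 : Y)
    (iso_f : bijective (@pi1_map R Y X f y0)) :
  (dcat1 R Y <= dcat1 R X)%E.
Proof.
(* Every [n] admissible for [X] is shown to be admissible for [Y]. *)
apply: le_ereal_inf => _ [n [E [q [[cov_q scE] [s [cs sK]]]]] <-].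
exists n => //; have [hausY [strY]] := cwY.
(* A point of the measure at [f y0] supplies a base point of the pullback over [y0]. *)
have [z [a [a0 a1 _ qz]]] := fiberwise_sum (s (f y0)).
have [i _] := sum1_gt0 a1 a0.
have qzi : f y0 = q (z i) by rewrite qz sK.
pose p0 : set_type (pullback_set f q) :=
  SigSub (mem_set (qzi : pullback_set f q (y0, z i))).
exists (pullback p0), pb_base; split; last first.
  exact: (has_section_pullback p0 hausY cwX (@cts_fun _ _ f) cov_q cs sK).
split; first exact: is_covering_pb (@cts_fun _ _ f) cov_q.
by apply: simply_connected_pb => //; exact: cw_path_connected strY connY.
Qed.
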